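(* Let $f:\mathbb{B}^n\to \mathbb{B}^n$ be holomorphic. Assume that $e_1$ is a boundary regular fixed point of $f$. Then for every $\epsilon>0$ and $t\in (0,1)$ and for every $A\subset \mathbb{B}^n$ admissible at $e_1$ there exist $M>1$ and $\delta>0$ such that $k_{\mathbb{B}^n}(z,f(K(M,t)e_1))<\epsilon$ for all $z\in A\cap \mathbb{B}(e_1,\delta)$.
   Context: $\mathbb{B}(a,r)=\{z\in\mathbb{C}^n:\|z-a\|<r\}$ is the Euclidean ball, $\mathbb{B}^n=\mathbb{B}(0,1)$, $e_1=(1,0,\ldots,0)\in\mathbb{C}^n$, $\mathbb{D}$ is the unit disc in $\mathbb{C}$, and $\pi(z_1,\ldots,z_n)=(z_1,0,\ldots,0)$. The Kobayashi distance of $\mathbb{B}^n$ is $k_{\mathbb{B}^n}(a,b)=\frac12\log\frac{1+\|T_a(b)\|}{1-\|T_a(b)\|}$, where $T_a$ is any automorphism of $\mathbb{B}^n$ with $T_a(a)=0$; for $A\subset\mathbb{B}^n$, $k_{\mathbb{B}^n}(z,A)=\inf_{w\in A}k_{\mathbb{B}^n}(z,w)$. For $M>1$ and $s>0$: $K(M,s):=\{\zeta\in\mathbb{D}:\frac{|1-\zeta|}{1-|\zeta|}<M,\ |1-\zeta|<s\}$ and $K(M,s)e_1:=\{\zeta e_1:\zeta\in K(M,s)\}\subset\mathbb{B}^n$. The cone of vertex $e_1$ and amplitude $M>1$ is $C(M):=\{z\in\mathbb{B}^n:\|e_1-z\|<M(1-\|z\|)\}$. A set $A\subset\mathbb{B}^n$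 with $e_1\in\overline{A}$ is admissible at $e_1$ if for every $\epsilon>0$ there exist $\delta>0$ and $M>1$ such that (1) $\pi(A\cap\mathbb{B}(e_1,\delta))\subset C(M)$, and (2) $k_{\mathbb{B}^n}(z,\pi(z))<\epsilon$ for every $z\in A\cap\mathbb{B}(e_1,\delta)$. For $f:\mathbb{B}^n\to\mathbb{B}^n$ holomorphic, $e_1$ is a boundary regular fixed point of $f$ if $\liminf_{z\to e_1}\frac{1-\|f(z)\|}{1-\|z\|}<+\infty$ and $\lim_{(0,1)\ni r\to1}f(re_1)=e_1$. *)

(* Defs.v *)
(* MathComp / MathComp-Analysis, with C^n (n >= 1) rendered as 'rV[R[i]]_n.+1. *)
From HB Require Import structures.
From mathcomp Require Import all_boot all_order all_algebra.
From mathcomp Require Import complex.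
From mathcomp Require Import all_classical all_reals all_analysis.

Set Implicit Arguments.
Unset Strict Implicit.
Unset Printing Implicit Defensive.

Import Order.TTheory GRing.Theory Num.Theory.
Import numFieldNormedType.Exports.
Local Open Scope complex_scope.
Local Open Scope classical_set_scope.
Local Open Scope ring_scope.

(* The library declares no topology on R[i]; give it the one of the numeric field
   R[i], induced by the modulus. *)
HB.instance Definition _ (R : rcfType) := NormedModule.copy R[i] R[i]^o.

Section BallDefs.
Variables (R : realType) (n : nat).
Implicit Types (a b z : 'rV[R[i]]_n.+1) (A : set 'rV[R[i]]_n.+1).
Implicit Types f g T : 'rV[R[i]]_n.+1 -> 'rV[R[i]]_n.+1.

(* The library norm on row vectors is the sup norm, with values in R[i]: it
   gives the usual topology of C^n, but not the Euclidean balls. *)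
Definition enorm z : R :=
  Num.sqrt (\sum_(j < n.+1) ComplexField.Normc.normc (z 0 j) ^+ 2).

Definition eball a (r : R) : set 'rV[R[i]]_n.+1 := [set z | enorm (z - a) < r].

Definition unit_ball : set 'rV[R[i]]_n.+1 := eball 0 1.

Definition e1 : 'rV[R[i]]_n.+1 := delta_mx 0 0.

Definition proj1 z : 'rV[R[i]]_n.+1 := z 0 0 *: e1.

(* Maps are total functions, of which only the values on the (open) unit ball
   matter; [differentiable] is Frechet differentiability over R[i], i.e. complex
   differentiability. *)
Definition holomorphic_self_map f : Prop :=
  (forall z, unit_ball z -> unit_ball (f z)) /\
  (forall z, unit_ball z -> differentiable f z).

Definition ball_automorphism T : Prop :=
  exists g, [/\ holomorphic_self_map T, holomorphic_self_map g,
    forall z, unit_ball z -> g (T z) = z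
    & forall z, unit_ball z -> T (g z) = z].

(* An automorphism of the unit ball sending a to 0, selected by choice: for a in
   the ball there is one, and two of them differ by a unitary map, so that
   [enorm (ball_aut a b)] does not depend on the selection. The default value
   [idfun] is used only when a is outside the ball. *)
Definition ball_aut a : 'rV[R[i]]_n.+1 -> 'rV[R[i]]_n.+1 :=
  xget (idfun : 'rV[R[i]]_n.+1 -> 'rV[R[i]]_n.+1)
    [set T | ball_automorphism T /\ T a = 0].

Definition kobayashi a b : R :=
  2^-1 * ln ((1 + enorm (ball_aut a b)) / (1 - enorm (ball_aut a b))).

(* The infimum is taken in the extended reals, so that it is +oo on the empty
   set. *)
Definition kobayashi_set z A : \bar R :=
  ereal_inf [set (kobayashi z w)%:E | w in A].

Definition Kregion (M s : R) : set R[i] :=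
  [set zeta | [/\ ComplexField.Normc.normc zeta < 1,
    ComplexField.Normc.normc (1 - zeta) / (1 - ComplexField.Normc.normc zeta) < M
    & ComplexField.Normc.normc (1 - zeta) < s]].

Definition Kregion_e1 (M s : R) : set 'rV[R[i]]_n.+1 :=
  [set zeta *: e1 | zeta in Kregion M s].

Definition cone (M : R) : set 'rV[R[i]]_n.+1 :=
  [set z | unit_ball z /\ enorm (e1 - z) < M * (1 - enorm z)].

Definition admissible A : Prop :=
  [/\ A `<=` unit_ball, closure A e1
    & forall eps : R, 0 < eps -> exists delta M : R,
        [/\ 0 < delta, 1 < M,
          [set proj1 z | z in A `&` eball e1 delta] `<=` cone M
          & forall z, (A `&` eball e1 delta) z -> kobayashi z (proj1 z) < eps]].

Definition boundary_regular_fixed_point f : Prop :=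
  (limf_einf (fun z => ((1 - enorm (f z)) / (1 - enorm z))%:E)
     (within unit_ball (nbhs e1)) < +oo)%E /\
  f (r%:C *: e1) @[r --> (1 : R)^'-] --> e1.

End BallDefs.

Arguments e1 {R n}.
Arguments unit_ball {R n}.

(* Main.v *)
Require Import Defs.
From mathcomp Require Import all_boot all_order all_algebra complex.
From mathcomp Require Import all_classical all_reals all_analysis.
From mathcomp Require Import ring lra.

Set Implicit Arguments.
Unset Strict Implicit.
Unset Printing Implicit Defensive.

Import Order.TTheory GRing.Theory Num.Theory.
Import numFieldNormedType.Exports.
Import ComplexField.Normc.
Local Open Scope classical_set_scope.
Local Open Scope ring_scope.
Local Notation Re := (@complex.Re _).
Local Notation Im := (@complex.Im _).

(** Write phi for the first coordinate of f on the slice D e_1, and transport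
the disc to the right half plane H by C(zeta) = (1 + zeta) / (1 - zeta), which
sends 1 to infinity and Stolz regions at 1 to the far parts of the sectors
|w| <= M Re w.  Let al be the liminf of (1 - |f(z)|) / (1 - |z|) at e_1 (it is
positive and finite) and F = C o phi o C^-1, a holomorphic map from H to H.

The Julia inequality (lemma [julia_inequality])
  |1 - f_1(z)|^2 / (1 - |f(z)|^2) <= al |1 - z_1|^2 / (1 - |z|^2),
read on the slice, says that Re F(w) - Re w / al is at least
|f'|^2 / |1 - phi|^2, where f' is the part of f(C^-1(w) e_1) orthogonal to e_1.
So the defect G(w) = F(w) - w / al + 1 maps H to H, and one bound
|G(w)| <= rho Re w controls two distances at once: from F(w) to w / al in H
(lemma [pdist_slice_point]), and from f(C^-1(w) e_1) to its projection on the
slice (lemma [pdist_slice_proj1]).  Since al is exactly the liminf,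
Re G(w) / Re w takes arbitrarily small values on the real axis (lemma
[slice_defect_small]); applying the Schwarz-Pick inequality of H to G between
w and one such point gives |G(w)| <= rho Re w far out in any given sector
(lemma [sublinear_in_sectors]).

Now let z in A be close to e_1, and u = C(z_1).  By admissibility u lies far
out in a fixed sector, and so does w = al u; hence zeta = C^-1(w) lies in
K(M, t) for a suitable M.  The distance from z to f(zeta e_1) is at most
k(z, pi z) + k(pi z, pi f(zeta e_1)) + k(pi f(zeta e_1), f(zeta e_1)): the
first term is small by admissibility, the others by the two bounds above.

Holomorphy is only pointwise differentiability, so function theory starts from
the Goursat theorem.  In the coordinates zeta = exp(x + i t) it shows that the
mean of h(zeta) / zeta over the circle of radius exp(x) does not depend on x;
letting x tend to -oo gives |h'(0)| <= 1 for a holomorphic self-map h of the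
disc with h(0) = 0.  Conjugation by Moebius maps turns this into the
infinitesimal Schwarz-Pick inequality, which is integrated along a radius to
give the Schwarz lemma.  Restriction to complex lines extends it to the ball;
with the involutions of the ball it yields the Schwarz-Pick inequality in C^n,
the explicit formula for k and the triangle inequality. *)

(** * Derivatives as affine approximations *)

(** The form of differentiability used in all estimates below; it serves both for
real and for complex functions. *)
Lemma is_derive_affine (K : numFieldType) (f : K -> K) (x c : K) :
  is_derive x 1 f c <-> forall e : K, 0 < e -> exists2 d : K, 0 < d &
    forall k, `|k| < d -> `|f (x + k) - f x - c * k| <= e * `|k|.
Proof.
have E (k : K) : k != 0 -> `|c - k^-1 *: (f (k *: 1 + x) - f x)| * `|k| =
    `|f (x + k) - f x - c * k|.
  move=> k0; rewrite -normrM distrC; congr `|_|.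
  rewrite mulrBl {1}/GRing.scale/= mulrAC mulVf// mul1r (addrC x).
  by rewrite {1}/GRing.scale/= mulr1.
split.
  move=> [dh hc] e e0.
  have : k^-1 *: (f (k *: 1 + x) - f x) @[k --> 0^'] --> c by rewrite -hc.
  move=> /cvgrPdist_le /(_ e e0) /nbhs_ballP[d /= d0 H]; exists d => // k kd.
  have [->|k0] := eqVneq k 0; first by rewrite addr0 mulr0 subr0 subrr normr0 mulr0.
  by rewrite -E// ler_pM2r ?normr_gt0//; apply: H => //; rewrite /ball/= sub0r normrN.
move=> H; have cv : k^-1 *: (f (k *: 1 + x) - f x) @[k --> 0^'] --> c.
  apply/cvgrPdist_le => e e0; have [d d0 {}H] := H e e0.
  apply/nbhs_ballP; exists d => //= k; rewrite /ball/= sub0r normrN => kd k0.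
  by rewrite -(@ler_pM2r _ `|k|) ?normr_gt0// E//; exact: H.
by apply: DeriveDef; [apply: cvgP cv|apply: cvg_lim cv].
Qed.

Lemma is_derive_quotient (K : numFieldType) (f g : K -> K) (z c c' : K) :
  is_derive z 1 f c -> is_derive z 1 g c' -> g z != 0 ->
  is_derive z 1 (fun w => f w / g w) ((c * g z - f z * c') / g z ^+ 2).
Proof.
move=> [df fE] [dg gE] g0.
have dV : derivable (fun w => (g w)^-1) z 1 by exact: derivableV.
have VE := deriveV g0 dg; have ME := deriveM df dV.
apply: DeriveDef; first exact: (derivableM df dV).
apply: etrans ME _; rewrite VE fE gE /GRing.scale /=; move: (g z) g0 (f z) => u u0 v.
by field.
Qed.

(** * Integrals of continuous functions over segments *)

Section RealIntegral.
Context {R : realType}.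
Implicit Types (F : R -> R) (a b c : R).

Definition intg F a b : R := \int[lebesgue_measure]_(x in `[a, b]) F x.

Definition continuous_on F a b := forall x, a <= x <= b -> {for x, continuous F}.

Lemma continuous_on_integrable F a b : continuous_on F a b ->
  lebesgue_measure.-integrable `[a, b] (EFin \o F).
Proof.
move=> cF; apply: continuous_compact_integrable; first exact: segment_compact.
apply: continuous_in_subspaceT => x; rewrite inE /= in_itv /= => xab.
exact: cF.
Qed.

Lemma intg_split F a b c : a <= b -> b <= c -> continuous_on F a c ->
  intg F a c = intg F a b + intg F b c.
Proof.
move=> ab bc cF.
have iF : lebesgue_measure.-integrable `[a, c] (EFin \o F) by exact: continuous_on_integrable.
have := @Rintegral_itvB R F (BLeft a) (BRight c) b iF.
rewrite !bnd_simp => /(_ ab bc) H.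
rewrite /intg -[X in _ = _ + X]Rintegral_itv_obnd_cbnd; first by rewrite -H addrC subrK.
apply: integrableS iF => //=; apply: subset_itv; rewrite ?bnd_simp//=.
Qed.

Lemma intgB F G a b : continuous_on F a b -> continuous_on G a b ->
  intg (fun x => F x - G x) a b = intg F a b - intg G a b.
Proof. by move=> cF cG; rewrite /intg RintegralB//; exact: continuous_on_integrable. Qed.

Lemma intg_cst (c a b : R) : a <= b -> intg (fun=> c) a b = c * (b - a).
Proof.
move=> ab; rewrite /intg Rintegral_cst//= lebesgue_measure_itv/= lte_fin.
case: ltP => // ba; have -> : a = b by apply/eqP; rewrite eq_le ab ba.
by rewrite subrr.
Qed.

Lemma intg_le F G a b : continuous_on F a b -> continuous_on G a b ->
  (forall x, a <= x <= b -> F x <= G x) -> intg F a b <= intg G a b.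
Proof.
move=> cF cG FG; apply: le_Rintegral => //; try exact: continuous_on_integrable.
Qed.

(** The only estimate on integrals that the Goursat argument needs: on a short
side the integrand is almost constant. *)
Lemma intg_near_cst F (c e a b : R) : a <= b -> continuous_on F a b ->
  (forall x, a <= x <= b -> `|F x - c| <= e) ->
  `|intg F a b - c * (b - a)| <= e * (b - a).
Proof.
move=> ab cF Fc.
have cst x : continuous_on (fun=> x : R) a b by move=> y _; exact: cst_continuous.
rewrite ler_distl -mulrBl -mulrDl -!intg_cst//.
by apply/andP; split; apply: intg_le => // x /Fc; rewrite ler_distl => /andP[].
Qed.

End RealIntegral.

(** * Goursat theorem for pointwise closed forms *)

Section Goursat.
Context {R : realType}.
Implicit Types (P Q : R -> R -> R) (x y a b e : R).

(** The form P dx + Q dy is differentiable at (x, y), with matrix of partial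
derivatives (al, be; be, ga): the equality of the cross derivatives is the
pointwise meaning of closedness. *)
Definition closed_form_at P Q x y := exists al be ga : R, forall e : R, 0 < e ->
  exists2 d : R, 0 < d & forall h k, `|h| < d -> `|k| < d ->
    `|P (x + h) (y + k) - P x y - (al * h + be * k)| <= e * (`|h| + `|k|) /\
    `|Q (x + h) (y + k) - Q x y - (be * h + ga * k)| <= e * (`|h| + `|k|).

Definition closed_form P Q x y a b := forall s t,
  x <= s <= x + a -> y <= t <= y + b -> closed_form_at P Q s t.

(** The integral of P dx + Q dy along the boundary of [x, x + a] x [y, y + b],
grouped by pairs of opposite sides. *)
Definition circulation P Q x y a b :=
  (intg (P ^~ y) x (x + a) - intg (P ^~ (y + b)) x (x + a)) +
  (intg (Q (x + a)) y (y + b) - intg (Q x) y (y + b)).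

Lemma affine_continuous (F : R -> R) x c :
  (forall e : R, 0 < e -> exists2 d : R, 0 < d & forall h, `|h| < d ->
     `|F (x + h) - F x - c * h| <= e * `|h|) -> {for x, continuous F}.
Proof.
move=> H; apply/(@cvgrPdist_le R R^o) => e e0.
have [d d0 Hd] := H 1 ltr01.
have c1 : 0 < `|c| + 1 by rewrite ltr_wpDl.
near=> z.
have zd : `|z - x| < Num.min d (e / (`|c| + 1)).
  rewrite distrC; near: z; apply/nbhs_ballP; exists (Num.min d (e / (`|c| + 1))) => //=.
  by rewrite lt_min d0 divr_gt0.
move: zd; rewrite lt_min => /andP[zd ze].
have := Hd _ zd; rewrite (addrC x) subrK mul1r => Hz.
rewrite distrC; have -> : F z - F x = (F z - F x - c * (z - x)) + c * (z - x) by ring.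
apply: le_trans (ler_normD _ _) _; rewrite normrM.
apply: (@le_trans _ _ ((`|c| + 1) * `|z - x|)); first by rewrite mulrDl mul1r addrC lerD2l.
by rewrite mulrC -ler_pdivlMr// ltW.
Unshelve. all: end_near. Qed.

Lemma closed_form_at_continuous P Q x y : closed_form_at P Q x y ->
  [/\ {for x, continuous (P ^~ y)}, {for y, continuous (P x)},
      {for x, continuous (Q ^~ y)} & {for y, continuous (Q x)}].
Proof.
move=> [al [be [ga H]]]; split.
- apply: (@affine_continuous _ _ al) => e /H[d d0 {}H]; exists d => // h hd.
  by have [+ _] := H h 0 hd (etrans (congr1 (fun x => x < d) (normr0 _)) d0);
    rewrite addr0 mulr0 normr0 !addr0.
- apply: (@affine_continuous _ _ be) => e /H[d d0 {}H]; exists d => // h hd.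
  by have [+ _] := H 0 h (etrans (congr1 (fun x => x < d) (normr0 _)) d0) hd;
    rewrite addr0 mulr0 normr0 !add0r.
- apply: (@affine_continuous _ _ be) => e /H[d d0 {}H]; exists d => // h hd.
  by have [_] := H h 0 hd (etrans (congr1 (fun x => x < d) (normr0 _)) d0);
    rewrite addr0 mulr0 normr0 !addr0.
- apply: (@affine_continuous _ _ ga) => e /H[d d0 {}H]; exists d => // h hd.
  by have [_] := H 0 h (etrans (congr1 (fun x => x < d) (normr0 _)) d0) hd;
    rewrite addr0 mulr0 normr0 !add0r.
Qed.

Lemma closed_form_sub P Q x y a b x' y' a' b' : closed_form P Q x y a b ->
  x <= x' -> x' + a' <= x + a -> y <= y' -> y' + b' <= y + b ->
  closed_form P Q x' y' a' b'.
Proof. by move=> H *; move=> s t /andP[? ?] /andP[? ?]; apply: H; lra. Qed.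

Lemma circulation_split P Q x y a b : 0 <= a -> 0 <= b -> closed_form P Q x y a b ->
  circulation P Q x y a b =
    circulation P Q x y (a / 2) (b / 2) +
    circulation P Q (x + a / 2) y (a / 2) (b / 2) +
    (circulation P Q x (y + b / 2) (a / 2) (b / 2) +
    circulation P Q (x + a / 2) (y + b / 2) (a / 2) (b / 2)).
Proof.
move=> a0 b0 H.
have HP t : y <= t <= y + b -> continuous_on (P ^~ t) x (x + a).
  by move=> ty s sx; have [] := closed_form_at_continuous (H _ _ sx ty).
have HQ s : x <= s <= x + a -> continuous_on (Q s) y (y + b).
  by move=> sx t ty; have [] := closed_form_at_continuous (H _ _ sx ty).
have spP t : y <= t <= y + b ->
   intg (P ^~ t) x (x + a) = intg (P ^~ t) x (x + a / 2) + intg (P ^~ t) (x + a / 2) (x + a).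
  by move=> ty; apply: intg_split; [lra|lra|exact: HP].
have spQ s : x <= s <= x + a ->
   intg (Q s) y (y + b) = intg (Q s) y (y + b / 2) + intg (Q s) (y + b / 2) (y + b).
  by move=> ty; apply: intg_split; [lra|lra|exact: HQ].
have aE : x + a / 2 + a / 2 = x + a by lra.
have bE : y + b / 2 + b / 2 = y + b by lra.
rewrite /circulation aE bE !spP ?spQ; first by ring. all: lra.
Qed.

(** The affine part of a closed form has circulation zero, because the two pairs
of opposite sides contribute - be a b and be a b; only the error term of the
affine approximation remains, and it is integrated over the perimeter. *)
Lemma circulation_small P Q x y a b s t be d e : 0 <= a < d -> 0 <= b < d -> 0 < e ->
  x <= s <= x + a -> y <= t <= y + b -> closed_form P Q x y a b ->
  (exists al ga : R, forall h k, `|h| < d -> `|k| < d ->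
    `|P (s + h) (t + k) - P s t - (al * h + be * k)| <= e * (`|h| + `|k|) /\
    `|Q (s + h) (t + k) - Q s t - (be * h + ga * k)| <= e * (`|h| + `|k|)) ->
  `|circulation P Q x y a b| <= 2 * e * (a + b) ^+ 2.
Proof.
move=> a0 b0 e0 sx ty H [al [ga Hst]].
have HP t' : y <= t' <= y + b -> continuous_on (P ^~ t') x (x + a).
  by move=> t'y s' s'x; have [] := closed_form_at_continuous (H _ _ s'x t'y).
have HQ s' : x <= s' <= x + a -> continuous_on (Q s') y (y + b).
  by move=> s'x t' t'y; have [] := closed_form_at_continuous (H _ _ s'x t'y).
have Hin s' t' : x <= s' <= x + a -> y <= t' <= y + b ->
    `|P s' t' - P s t - (al * (s' - s) + be * (t' - t))| <= e * (a + b) /\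
    `|Q s' t' - Q s t - (be * (s' - s) + ga * (t' - t))| <= e * (a + b).
  move=> s'x t'y.
  have ha : `|s' - s| <= a by rewrite ler_norml; lra.
  have hb : `|t' - t| <= b by rewrite ler_norml; lra.
  have [] := Hst (s' - s) (t' - t); [lra|lra|].
  rewrite !(addrC s, addrC t) !subrK => h1 h2.
  by split; [apply: le_trans h1 _|apply: le_trans h2 _]; rewrite ler_pM2l// lerD.
have yy : y <= y <= y + b by lra.
have yb : y <= y + b <= y + b by lra.
have xx : x <= x <= x + a by lra.
have xa : x <= x + a <= x + a by lra.
rewrite /circulation -intgB; [|exact: HP|exact: HP].
rewrite -intgB; [|exact: HQ|exact: HQ].
set I1 := intg _ x _; set I2 := intg _ y _.
have h1 : `|I1 - - be * b * (x + a - x)| <= 2 * e * (a + b) * (x + a - x).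
  apply: intg_near_cst; first lra.
    by move=> z zx; apply: continuousB; [exact: (HP _ yy)|exact: (HP _ yb)].
  move=> z zx; have [+ _] := Hin _ _ zx yy; have [+ _] := Hin _ _ zx yb.
  by rewrite !ler_norml; lra.
have h2 : `|I2 - be * a * (y + b - y)| <= 2 * e * (a + b) * (y + b - y).
  apply: intg_near_cst; first lra.
    by move=> z zx; apply: continuousB; [exact: (HQ _ xa)|exact: (HQ _ xx)].
  move=> z zx; have [_ +] := Hin _ _ xa zx; have [_ +] := Hin _ _ xx zx.
  by rewrite !ler_norml; lra.
move: h1 h2; rewrite !ler_norml; nra.
Qed.

Lemma circulation_quarter P Q x y a b : 0 <= a -> 0 <= b -> closed_form P Q x y a b ->
  exists p : R * R, [/\ x <= p.1, p.1 + a / 2 <= x + a, y <= p.2, p.2 + b / 2 <= y + b &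
    `|circulation P Q x y a b| / 4 <= `|circulation P Q p.1 p.2 (a / 2) (b / 2)|].
Proof.
move=> a0 b0 H; have E := circulation_split a0 b0 H.
have four (c c1 c2 c3 c4 : R) : c = c1 + c2 + (c3 + c4) ->
    [\/ `|c| / 4 <= `|c1|, `|c| / 4 <= `|c2|, `|c| / 4 <= `|c3| | `|c| / 4 <= `|c4| ].
  move=> ->; have cle : `|c1 + c2 + (c3 + c4)| <= `|c1| + `|c2| + (`|c3| + `|c4|).
    by rewrite (le_trans (ler_normD _ _))// lerD// ler_normD.
  move: `|c1 + c2 + (c3 + c4)| `|c1| `|c2| `|c3| `|c4| cle => m x1 x2 x3 x4 cle.
  have [h1|h1] := leP (m / 4) x1; first by apply: Or41.
  have [h2|h2] := leP (m / 4) x2; first by apply: Or42.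
  have [h3|h3] := leP (m / 4) x3; first by apply: Or43.
  by apply: Or44; lra.
have sides (u : R) : 0 <= u -> u / 2 + u / 2 <= u /\ 0 <= u / 2 /\ u / 2 <= u by lra.
have [ha [ha' ha'']] := sides a a0; have [hb [hb' hb'']] := sides b b0.
case: (four _ _ _ _ _ E) => h; [exists (x, y)|exists (x + a / 2, y)|
  exists (x, y + b / 2)|exists (x + a / 2, y + b / 2)]; split => //=;
  by rewrite ?lerDl ?lerD2l// -addrA lerD2l.
Qed.

Lemma nested_point (X l : nat -> R) : (forall n, 0 <= l n) ->
  (forall n, X n <= X n.+1) -> (forall n, X n.+1 + l n.+1 <= X n + l n) ->
  exists s, forall n, X n <= s <= X n + l n.
Proof.
move=> l0 Xi Xd.
have Xle m n : X m <= X (m + n)%N.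
  by elim: n => [|n IH]; rewrite ?addn0// addnS (le_trans IH).
have Xge m n : X (m + n)%N + l (m + n)%N <= X m + l m.
  by elim: n => [|n IH]; rewrite ?addn0// addnS (le_trans _ IH).
have ub n : ubound (range X) (X n + l n).
  move=> _ [m _ <-]; have := Xle m n; have := Xge n m; have := l0 (n + m)%N.
  by rewrite (addnC m n); lra.
have hs : has_sup (range X) by split; [exists (X 0%N), 0%N|exists (X 0%N + l 0%N)].
exists (sup (range X)) => n; apply/andP; split.
  by apply: ub_le_sup; [exact: hs.2|exists n].
by apply: ge_sup; [exact: hs.1|exact: ub].
Qed.

Lemma half_power_small (r d : R) : 0 < d -> exists n, r / 2 ^+ n < d.
Proof.
move=> d0; exists (Num.bound `|r / d|).
set n := Num.bound _; have h : `|r / d| < n%:R by rewrite archi_boundP.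
have h2 : n%:R <= (2 : R) ^+ n by rewrite -natrX ler_nat ltnW// ltn_expl.
rewrite ltr_pdivrMr ?exprn_gt0// mulrC -ltr_pdivrMr//.
by rewrite (le_lt_trans (ler_norm _))// (lt_le_trans h).
Qed.

(** By bisection: one of the four quarters carries at least a fourth of the
circulation. The nested quarters shrink to a point (s, t), where
differentiability makes the circulation negligible with respect to the area. *)
Theorem goursat P Q x y a b : 0 <= a -> 0 <= b -> closed_form P Q x y a b ->
  circulation P Q x y a b = 0.
Proof.
move=> a0 b0 H; apply/eqP; apply: contraT; rewrite -normr_gt0.
set E := `|_| => E0.
pose l (r : R) n := r / 2 ^+ n.
have l_ge0 r n : 0 <= r -> 0 <= l r n by move=> r0; rewrite divr_ge0// exprn_ge0.
have lS r n : l r n.+1 = l r n / 2 by rewrite /l exprSr invfM mulrA.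
pose Inv n (p : R * R) := closed_form P Q p.1 p.2 (l a n) (l b n) /\
  E / 4 ^+ n <= `|circulation P Q p.1 p.2 (l a n) (l b n)|.
have step (np : nat * (R * R)) : exists p : R * R, Inv np.1 np.2 ->
   [/\ Inv np.1.+1 p, np.2.1 <= p.1, p.1 + l a np.1.+1 <= np.2.1 + l a np.1,
    np.2.2 <= p.2 & p.2 + l b np.1.+1 <= np.2.2 + l b np.1].
  case: np => n [u v] /=; have [[/= cf le]|nI] := pselect (Inv n (u, v)); last by exists 0.
  have [p [h1 h2 h3 h4 h5]] := circulation_quarter (l_ge0 a n a0) (l_ge0 b n b0) cf.
  exists p => _; rewrite !lS; split => //; split; rewrite !lS.
    exact: closed_form_sub cf _ _ _ _.
  rewrite (le_trans _ h5)// exprSr invfM mulrA ler_pM2r// ; lra.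
have {step} [g Hg] := choice step.
pose p := fix p n := if n is n'.+1 then g (n', p n') else (x, y).
have HI n : Inv n (p n).
  elim: n => [|n /(Hg (n, p n)) []//].
  by rewrite /Inv /l /= !expr0 !divr1.
have Hp n : [/\ Inv n.+1 (p n.+1), (p n).1 <= (p n.+1).1, (p n.+1).1 + l a n.+1 <= (p n).1 + l a n,
    (p n).2 <= (p n.+1).2 & (p n.+1).2 + l b n.+1 <= (p n).2 + l b n] := Hg (n, p n) (HI n).
have [s Hs] : exists s, forall n, (p n).1 <= s <= (p n).1 + l a n.
  by apply: nested_point => n; [exact: l_ge0|case: (Hp n)|case: (Hp n)].
have [t Ht] : exists s, forall n, (p n).2 <= s <= (p n).2 + l b n.
  by apply: nested_point => n; [exact: l_ge0|case: (Hp n)|case: (Hp n)].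
(* The error e is chosen so that 2 e (a + b)^2 < E. *)
have [al [be [ga Hst]]] : closed_form_at P Q s t.
  by have := Hs 0%N; have := Ht 0%N; rewrite /= /l expr0 !divr1 => ? ?; exact: H.
pose e := E / (2 * (a + b) ^+ 2 + 1) / 2.
have k0 : 0 < 2 * (a + b) ^+ 2 + 1 by rewrite ltr_wpDl// mulr_ge0// sqr_ge0.
have e0 : 0 < e by rewrite /e !divr_gt0.
have [d d0 {}Hst] := Hst e e0.
have [n nd] := half_power_small (a + b) d0.
have [cf le] := HI n.
have la : 0 <= l a n < d.
  rewrite l_ge0//= (le_lt_trans _ nd)// ler_pM2r ?invr_gt0 ?exprn_gt0//; lra.
have lb : 0 <= l b n < d.
  rewrite l_ge0//= (le_lt_trans _ nd)// ler_pM2r ?invr_gt0 ?exprn_gt0//; lra.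
have := @circulation_small P Q (p n).1 (p n).2 (l a n) (l b n) s t be d e la lb e0 (Hs n) (Ht n) cf.
move=> /(_ (ex_intro _ al (ex_intro _ ga Hst))) up.
have := le_trans le up.
have -> : 2 * e * (l a n + l b n) ^+ 2 = 2 * e * (a + b) ^+ 2 / 4 ^+ n.
  rewrite /l -mulrDl exprMn -exprVn -exprM mulnC exprM -!mulrA; congr (_ * (_ * (_ * _))).
  by rewrite exprVn expr2 -natrM exprVn.
rewrite ler_pM2r ?invr_gt0 ?exprn_gt0// => {}up.
suff : 2 * e * (a + b) ^+ 2 < E by lra.
have -> : 2 * e * (a + b) ^+ 2 = E * ((a + b) ^+ 2 / (2 * (a + b) ^+ 2 + 1)).
  by rewrite /e; field; lra.
rewrite gtr_pMr// ltr_pdivrMr// mul1r; have := sqr_ge0 (a + b); lra.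
Qed.

(** When P has period T in y, the horizontal sides of a rectangle of height T
cancel each other. *)
Lemma circulation_periodic P Q T x1 x2 : 0 <= T -> x1 <= x2 ->
  closed_form P Q x1 0 (x2 - x1) T -> (forall s, P s T = P s 0) ->
  intg (Q x1) 0 T = intg (Q x2) 0 T.
Proof.
move=> T0 x12 /goursat; rewrite subr_ge0 => /(_ x12 T0).
rewrite /circulation !add0r (addrC x1) subrK => + PT.
rewrite (_ : P^~ T = P^~ 0); last exact/funext.
by rewrite subrr add0r => /subr0_eq.
Qed.

End Goursat.

(** * Complex numbers and complex derivatives *)

Section ComplexDerivative.
Context {R : realType}.
Local Open Scope complex_scope.
Implicit Types (h : R[i] -> R[i]) (z c k w : R[i]) (e d : R).

Lemma normc_ge0 z : 0 <= normc z.
Proof. by case: z => a b /=; rewrite sqrtr_ge0. Qed.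

Lemma normc_sq z : normc z ^+ 2 = Re z ^+ 2 + Im z ^+ 2.
Proof. by case: z => a b /=; rewrite sqr_sqrtr// addr_ge0// sqr_ge0. Qed.

Lemma normc_gt0 z : z != 0 -> 0 < normc z.
Proof.
by move=> z0; rewrite lt_def normc_ge0 andbT; apply: contra z0 => /eqP/eq0_normc ->.
Qed.

Lemma mulc_conj z : z * z^*%C = (normc z ^+ 2)%:C.
Proof.
rewrite normc_sq; case: z => x y /=; apply/eqP; rewrite eq_complex /=.
by apply/andP; split; apply/eqP; ring.
Qed.

Lemma normc_conj z : normc z^*%C = normc z.
Proof. by case: z => x y /=; rewrite sqrrN. Qed.

Lemma normr_Re_normc z : `|Re z| <= normc z.
Proof.
rewrite -ler_sqr ?nnegrE ?normc_ge0// normc_sq real_normK ?num_real//.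
by rewrite lerDl sqr_ge0.
Qed.

Lemma normr_Im_normc z : `|Im z| <= normc z.
Proof.
rewrite -ler_sqr ?nnegrE ?normc_ge0// normc_sq real_normK ?num_real//.
by rewrite lerDr sqr_ge0.
Qed.

Lemma normc_real (x : R) : normc x%:C = `|x|.
Proof. by rewrite /= expr0n /= addr0 sqrtr_sqr. Qed.

Lemma normc_ReIm (a b : R) : normc (a +i* b) <= `|a| + `|b|.
Proof.
rewrite -ler_sqr ?nnegrE ?normc_ge0 ?addr_ge0// normc_sq /=.
rewrite sqrrD !real_normK ?num_real//; have := mulr_ge0 (normr_ge0 a) (normr_ge0 b); lra.
Qed.

Lemma normCE z : `|z| = (normc z)%:C.
Proof. by []. Qed.

(** Real radii e and d, instead of radii in the field of complex numbers. *)
Definition cderiv_at h z c := forall e, 0 < e -> exists2 d, 0 < d &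
  forall k, normc k < d -> normc (h (z + k) - h z - c * k) <= e * normc k.

Lemma cderiv_atP h z c : cderiv_at h z c <-> is_derive z 1 h c.
Proof.
split=> [H|/(is_derive_affine h z c) H e e0].
  apply/(is_derive_affine h z c) => [[e e']]; rewrite ltcE/= => /andP[/eqP -> e0].
  have [d d0 {}H] := H e e0; exists d%:C => [|k]; first by rewrite ltcR.
  by rewrite ltcR => /H kd; rewrite !normCE -[e +i* 0]/(e%:C) -rmorphM lecR.
have [|[d d'] + {}H] := H e%:C; first by rewrite ltcR.
rewrite ltcE/= => /andP[/eqP dE d0]; exists d => // k kd.
have := H k; rewrite dE !normCE -[d +i* 0]/(d%:C) ltcR -rmorphM lecR; exact.
Qed.

Lemma differentiable_cderiv h z : differentiable h z -> exists c, cderiv_at h z c.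
Proof.
move=> dh; exists ('D_1 h z); apply/cderiv_atP; apply: derivableP.
exact/derivable1_diffP.
Qed.

Lemma cderiv_differentiable h z c : cderiv_at h z c -> differentiable h z.
Proof. by move=> /cderiv_atP[dh _]; apply/derivable1_diffP. Qed.

End ComplexDerivative.

(** * The complex exponential *)

Section ComplexExponential.
Context {R : realType}.
Local Open Scope complex_scope.
Implicit Types (h : R[i] -> R[i]) (z c k w : R[i]) (e d : R).

Definition cexp w : R[i] := (expR (Re w) * cos (Im w)) +i* (expR (Re w) * sin (Im w)).

Lemma cexpD w z : cexp (w + z) = cexp w * cexp z.
Proof.
case: w z => a b [a' b']; rewrite /cexp /= expRD cosD sinD; apply/eqP.
by rewrite eq_complex /=; apply/andP; split; apply/eqP; ring.
Qed.

Lemma normc_cexp w : normc (cexp w) = expR (Re w).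
Proof.
apply/eqP; rewrite -(eqrXn2 (n:=2))// ?normc_ge0 ?expR_ge0//; apply/eqP.
by rewrite normc_sq /= !exprMn -mulrDr cos2Dsin2 mulr1.
Qed.

Lemma cexp_neq0 w : cexp w != 0.
Proof.
by apply/eqP => /(congr1 (@normc R)) /eqP; rewrite normc_cexp normc0 gt_eqF ?expR_gt0.
Qed.

(** The real and imaginary parts of exp(a + i b) - 1 - (a + i b) are
E (C - 1) + (E - 1 - a) and (E - 1) S + (S - b) with E = exp a, C = cos b,
S = sin b, where C - 1, E - 1, S and the Taylor remainders are small. *)
Lemma cexp_cderiv0 : cderiv_at cexp 0 1.
Proof.
move=> e e0.
(* The four error terms add up to at most 9 e' |k|. *)
pose e' := Num.min 1 (e / 9).
have e'0 : 0 < e' by rewrite lt_min ltr01 divr_gt0.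
have e'1 : e' <= 1 by rewrite ge_min lexx.
have e'e : e' <= e / 9 by rewrite ge_min lexx orbT.
clearbody e'.
have [d1 d10 H1] := (is_derive_affine _ _ _).1 (is_derive_expR 0) _ e'0.
have [d2 d20 H2] := (is_derive_affine _ _ _).1 (is_derive_cos 0) _ e'0.
have [d3 d30 H3] := (is_derive_affine _ _ _).1 (is_derive_sin 0) _ e'0.
exists (Num.min (Num.min d1 d2) (Num.min d3 e')).
  by rewrite !lt_min d10 d20 d30 e'0.
move=> k; rewrite !lt_min => /andP[/andP[kd1 kd2] /andP[kd3 ke]].
have ra := normr_Re_normc k; have rb := normr_Im_normc k; have n0 := normc_ge0 k.
rewrite add0r mul1r; move: (normc k) kd1 kd2 kd3 ke ra rb n0 => m kd1 kd2 kd3 ke.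
case: k => a b ra rb n0; rewrite /= in ra rb.
have {}H1 := H1 a (le_lt_trans ra kd1).
have {}H2 := H2 b (le_lt_trans rb kd2).
have {}H3 := H3 b (le_lt_trans rb kd3).
rewrite add0r expR0 in H1. rewrite add0r cos0 sin0 in H2. rewrite add0r cos0 sin0 in H3.
have -> : cexp (a +i* b) - cexp 0 - (a +i* b) =
    (expR a * cos b - 1 - a) +i* (expR a * sin b - b).
  by apply/eqP; rewrite eq_complex /= expR0 sin0 cos0 !mulr1 mulr0 subr0 !eqxx.
apply: le_trans (normc_ReIm _ _) _.
move: (expR a) (cos b) (sin b) H1 H2 H3 => E C S H1 H2 H3.
have e'a : e' * `|a| <= e' * m by rewrite ler_pM2l.
have e'b : e' * `|b| <= e' * m by rewrite ler_pM2l.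
have X1 : `|E - 1 - a| <= e' * m by apply: le_trans e'a; rewrite mul1r in H1.
have X2 : `|C - 1| <= e' * m by apply: le_trans e'b; rewrite oppr0 mul0r subr0 in H2.
have X3 : `|S - b| <= e' * m by apply: le_trans e'b; rewrite mul1r subr0 in H3.
have mm : e' * m <= m by rewrite ler_piMl.
have e'm : m <= e' by exact: ltW.
have E1 : `|E - 1| <= 2 * m by move: X1 ra; rewrite !ler_norml; lra.
have E2 : `|E| <= 3 by move: E1; rewrite !ler_norml; lra.
have S1 : `|S| <= 2 * m by move: X3 rb; rewrite !ler_norml; lra.
have -> : E * C - 1 - a = E * (C - 1) + (E - 1 - a) by ring.
have -> : E * S - b = (E - 1) * S + (S - b) by ring.
have Y1 : `|E * (C - 1)| <= 3 * (e' * m) by rewrite normrM ler_pM.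
have Y2 : `|(E - 1) * S| <= (2 * m) * (2 * m) by rewrite normrM ler_pM.
have Y3 : (2 * m) * (2 * m) <= 4 * (e' * m) by nra.
have Y4 : e' * m <= e / 9 * m by rewrite ler_wpM2r.
have T1 := ler_normD (E * (C - 1)) (E - 1 - a).
have T2 := ler_normD ((E - 1) * S) (S - b).
lra.
Qed.

Lemma cexp_cderiv w : cderiv_at cexp w (cexp w).
Proof.
move=> e e0; have c0 : 0 < normc (cexp w) by rewrite normc_cexp expR_gt0.
have [d d0 H] := cexp_cderiv0 (divr_gt0 e0 c0); exists d => // k /H; rewrite add0r.
have H0 : cexp 0 = 1 by rewrite /cexp /= expR0 sin0 cos0 mulr1 mulr0.
rewrite H0 mul1r cexpD => {}H.
have -> : cexp w * cexp k - cexp w - cexp w * k = cexp w * (cexp k - 1 - k) by ring.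
rewrite normcM; apply: le_trans (ler_wpM2l (ltW c0) H) _.
by rewrite mulrA mulrCA divff ?gt_eqF// mulr1.
Qed.

End ComplexExponential.

(** * The Schwarz bound for the derivative at the origin *)

Section SchwarzDerivative.
Context {R : realType}.
Local Open Scope complex_scope.
Implicit Types (h g : R[i] -> R[i]) (z c k w : R[i]) (e d : R).

(** Re (g dz) is closed: this is one of the two Cauchy-Riemann equations. *)
Lemma holomorphic_closed_form g (x y : R) c : cderiv_at g (x +i* y) c ->
  closed_form_at (fun s t => Re (g (s +i* t))) (fun s t => - Im (g (s +i* t))) x y.
Proof.
move=> H; exists (Re c), (- Im c), (- Re c) => e e0.
have [d d0 {}H] := H e e0; exists (d / 2) => [|h k hd kd]; first by rewrite divr_gt0.
have hk := normc_ReIm h k.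
have := H (h +i* k); rewrite (le_lt_trans hk); last by lra.
move=> /(_ isT).
have -> : (x +i* y) + (h +i* k) = (x + h) +i* (y + k) by [].
set u := g _; set v := g _ => {}H.
have {}H : normc (u - v - c * (h +i* k)) <= e * (`|h| + `|k|).
  by apply: le_trans H _; rewrite ler_pM2l.
split; [apply: le_trans H; apply: le_trans (normr_Re_normc _)
       |apply: le_trans H; apply: le_trans (normr_Im_normc _)].
- rewrite le_eqVlt; apply/orP; left; apply/eqP; congr `|_|.
  by case: u v c => [u1 u2] [v1 v2] [c1 c2] /=; ring.
- rewrite le_eqVlt; apply/orP; left; apply/eqP; rewrite -normrN; congr `|_|.
  by case: u v c => [u1 u2] [v1 v2] [c1 c2] /=; ring.
Qed.

Definition unit_disc z := normc z < 1.

Lemma cexp_2pi (s : R) : cexp (s +i* (2 * pi)) = cexp (s +i* 0).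
Proof. by rewrite /cexp /= mulr_natl cos2pi sin2pi cos0 sin0. Qed.

Lemma logpolar_closed_form h (s t : R) :
  (forall z, unit_disc z -> differentiable h z) -> s < 0 ->
  closed_form_at (fun s t => Re (h (cexp (s +i* t)) / cexp (s +i* t)))
                 (fun s t => - Im (h (cexp (s +i* t)) / cexp (s +i* t))) s t.
Proof.
move=> dh s0; have [c] : exists c, cderiv_at (fun w => h (cexp w) / cexp w) (s +i* t) c.
  apply: differentiable_cderiv.
  have de : differentiable (@cexp R) (s +i* t) by exact: cderiv_differentiable (cexp_cderiv _).
  have dhe : differentiable h (cexp (s +i* t)).
    by apply: dh; rewrite /unit_disc normc_cexp /= expR_lt1; lra.
  apply: (@differentiableM _ _ (h \o @cexp R) (fun w => (cexp w)^-1)).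
    exact: differentiable_comp de dhe.
  exact: (@differentiableV _ _ (@cexp R) _ de (cexp_neq0 _)).
exact: holomorphic_closed_form.
Qed.

(** The form Re (h(exp w) / exp w dw) is closed on the half plane Re w < 0 and has
period 2 pi in the direction of i, so its integral over a vertical period does
not depend on the abscissa. Only the imaginary part of the mean value of
h(zeta) / zeta over a circle appears. *)
Lemma logpolar_mean h (x1 x2 : R) : (forall z, unit_disc z -> differentiable h z) ->
  x1 <= x2 -> x2 < 0 ->
  intg (fun t => - Im (h (cexp (x1 +i* t)) / cexp (x1 +i* t))) 0 (2 * pi) =
  intg (fun t => - Im (h (cexp (x2 +i* t)) / cexp (x2 +i* t))) 0 (2 * pi).
Proof.
move=> dh x12 x20.
have pi0 : 0 <= 2 * pi :> R by rewrite mulr_ge0// pi_ge0.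
pose Q s t := - Im (h (cexp (s +i* t)) / cexp (s +i* t)).
apply: (@circulation_periodic R (fun s t => Re (h (cexp (s +i* t)) / cexp (s +i* t))) Q) => //.
  by move=> s t sx _; apply: logpolar_closed_form => //; lra.
by move=> s; rewrite cexp_2pi.
Qed.

(** The rotation that makes a given number a negative multiple of i, the
direction seen by the real integrals above. *)
Lemma rotation_to_Im c : exists2 u, normc u = 1 & - Im (u * c) = normc c.
Proof.
have [->|c0] := eqVneq c 0; first by exists 1; rewrite ?normc1// mulr0 normc0 /= oppr0.
have n0 := normc_gt0 c0.
exists (- 'i%C * c^*%C / (normc c)%:C).
  have ni : normc (- 'i%C : R[i]) = 1 by rewrite normcN /= expr0n /= add0r expr1n sqrtr1.
  by rewrite !normcM normcV normc_real normc_conj ni mul1r ger0_norm ?normc_ge0// divff ?gt_eqF.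
have -> : - 'i%C * c^*%C / (normc c)%:C * c = - 'i%C * (normc c)%:C.
  rewrite mulrAC -!mulrA; congr (_ * _); rewrite mulrA.
  rewrite (mulrC _^*%C) mulc_conj.
  by rewrite expr2 rmorphM mulfK// fmorph_eq0 gt_eqF.
by move: (normc c) => m; rewrite /=; ring.
Qed.

(** Over a small circle, h(zeta) / zeta is close to c; over a circle of radius
close to 1 its modulus is at most slightly more than 1. The two means are
equal. *)
Lemma schwarz_derivative h c : (forall z, unit_disc z -> differentiable h z) ->
  (forall z, unit_disc z -> normc (h z) <= 1) -> h 0 = 0 -> cderiv_at h 0 c ->
  normc c <= 1.
Proof.
move=> dh h1 h0 hc; rewrite leNgt; apply/negP => c1.
have [eta eta0 ceta] : exists2 eta, 0 < eta & normc c = 1 + 2 * eta.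
  by exists ((normc c - 1) / 2); lra.
have [u u1 uc] := rotation_to_Im c.
have [d d0 Hd] := hc eta eta0.
have m0 : 0 < 1 + eta / 2 by lra.
(* x2 is the outer circle, x1 the inner one, inside the disc where h is
   affine up to eta. *)
have [x2 x20 Ex2] : exists2 x2, x2 < 0 & expR x2 = (1 + eta / 2)^-1.
  exists (- ln (1 + eta / 2)); first by rewrite oppr_lt0 ln_gt0//; lra.
  by rewrite expRN lnK.
have [x1 x12 x1d] : exists2 x1, x1 <= x2 & expR x1 < d.
  exists (Num.min x2 (ln (d / 2))); first by rewrite ge_min lexx.
  have : expR (Num.min x2 (ln (d / 2))) <= expR (ln (d / 2)).
    by rewrite ler_expR ge_min lexx orbT.
  rewrite lnK ?posrE ?divr_gt0//; lra.
have x10 : x1 < 0 by lra.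
have cont x : x < 0 ->
    continuous_on (fun t => - Im (u * h (cexp (x +i* t)) / cexp (x +i* t))) 0 (2 * pi).
  move=> x0 t _.
  have du z : unit_disc z -> differentiable (fun z => u * h z) z.
    by move=> /dh; exact: differentiableZ.
  by have [] := closed_form_at_continuous (logpolar_closed_form t du x0).
have du z : unit_disc z -> differentiable (fun z => u * h z) z.
  by move=> /dh; exact: differentiableZ.
have pi0 : 0 < 2 * pi :> R by rewrite mulr_gt0// pi_gt0.
have cst (m : R) : continuous_on (fun=> m) 0 (2 * pi) by move=> y _; exact: cst_continuous.
have := logpolar_mean du x12 x20; set I1 := intg _ _ _; set I2 := intg _ _ _ => I12.
have le1 : (normc c - eta) * (2 * pi - 0) <= I1.
  rewrite -(intg_cst (normc c - eta) (ltW pi0)); apply: intg_le; [exact: cst|exact: cont|].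
  move=> t _; set k := cexp _.
  have k0 : k != 0 by exact: cexp_neq0.
  have nk : normc k = expR x1 by rewrite normc_cexp.
  have kp : 0 < normc k by rewrite nk expR_gt0.
  have := Hd k; rewrite nk => /(_ x1d); rewrite add0r h0 subr0 -nk => {}Hd.
  have : normc (u * h k / k - u * c) <= eta.
    rewrite (_ : _ - _ = u * (h k - c * k) / k); last by field.
    by rewrite !normcM u1 mul1r normcV ler_pdivrMr.
  move=> H; have := le_trans (normr_Im_normc _) H.
  rewrite -uc ler_norml; case: (u * h k / k) (u * c) => [a b] [a' b'] /=; lra.
have le2 : I2 <= (1 + eta / 2) * (2 * pi - 0).
  rewrite -(intg_cst (1 + eta / 2) (ltW pi0)); apply: intg_le; [exact: cont|exact: cst|].
  move=> t _; set k := cexp _.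
  have nk : normc k = expR x2 by rewrite normc_cexp.
  have kp : 0 < normc k by rewrite nk expR_gt0.
  have kD : unit_disc k by rewrite /unit_disc nk expR_lt1.
  apply: le_trans (ler_norm _) _; rewrite normrN; apply: le_trans (normr_Im_normc _) _.
  rewrite !normcM u1 mul1r normcV nk Ex2 invrK.
  have hk1 := h1 k kD; rewrite -[X in _ <= X]mul1r ler_pM2r//.
move: le1 le2; rewrite {}I12; clearbody I2 => le1 /(le_trans le1).
by rewrite subr0 ler_pM2r// ceta; lra.
Qed.

End SchwarzDerivative.

(** * The Schwarz lemma in the disc *)

(** The inequality v' / (1 - v^2) <= 1 / (1 - t^2) integrates to
artanh (v r) <= artanh r; the proof differentiates the rational
function exp (2 artanh (v t) - 2 artanh t). *)
Lemma artanh_comparison (R : realType) (v : R -> R) (r : R) : 0 < r < 1 -> v 0 = 0 ->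
  (forall t : R, 0 <= t <= r -> -1 < v t < 1) ->
  (forall t : R, 0 <= t <= r -> exists2 v' : R, is_derive t 1 v v' &
     v' * (1 - t ^+ 2) <= 1 - v t ^+ 2) ->
  v r <= r.
Proof.
move=> r01 v0 vb dv.
pose psi t := ((1 + v t) * (1 - t)) / ((1 - v t) * (1 + t)).
have den t : 0 <= t <= r -> 0 < (1 - v t) * (1 + t).
  by move=> tr; have vt := vb t tr; apply: mulr_gt0; lra.
have dpsi t : 0 <= t <= r -> exists2 p : R, is_derive t 1 psi p & p <= 0.
  move=> tr; have [v' hv' le] := dv t tr.
  have h1 : is_derive t 1 (fun t => (1 + v t) * (1 - t)) (v' * (1 - t) - (1 + v t)).
    apply: is_derive_eq; rewrite /GRing.scale /=; ring.
  have h2 : is_derive t 1 (fun t => (1 - v t) * (1 + t)) (- v' * (1 + t) + (1 - v t)).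
    apply: is_derive_eq; rewrite /GRing.scale /=; ring.
  have := is_derive_quotient h1 h2 (lt0r_neq0 (den t tr)) => hp.
  eexists; first exact: hp.
  rewrite pmulr_lle0 ?invr_gt0 ?exprn_gt0// ?den//.
  rewrite (_ : _ - _ = 2 * (v' * (1 - t ^+ 2) - (1 - v t ^+ 2))); last by ring.
  lra.
have [p Hp] : exists p, forall t, 0 <= t <= r -> is_derive t 1 psi (p t) /\ p t <= 0.
  have : forall t, exists p, 0 <= t <= r -> is_derive t 1 psi p /\ p <= 0.
    move=> t; case: (boolP (0 <= t <= r)) => tr; last by exists 0.
    by have [p ? ?] := dpsi t tr; exists p.
  by move=> /choice[p Hp]; exists p.
have r0 : 0 < r by case/andP: r01.
have cpsi : {within `[0, r], continuous psi}.
  apply: continuous_in_subspaceT => x; rewrite inE /= in_itv /= => xr.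
  have [[+ _] _] := Hp x xr; move=> /derivable1_diffP; exact: differentiable_continuous.
have dpsi' x : x \in `]0, r[ -> is_derive x 1 psi (p x).
  by rewrite in_itv /= => xr; apply: (Hp x _).1; lra.
have [c cr E] := MVT r0 dpsi' cpsi.
rewrite in_itv /= in cr; have [_ pc] := Hp c ltac:(lra).
have : psi r <= psi 0 by rewrite -subr_le0 E subr0 mulr_le0_ge0// ltW.
have rr : 0 <= r <= r by lra.
rewrite [X in _ <= X](_ : _ = 1); last by rewrite /psi v0 !addr0 !subr0 !mulr1 divr1.
rewrite /psi ler_pdivrMr ?den//; lra.
Qed.

Section SchwarzLemma.
Context {R : realType}.
Local Open Scope complex_scope.
Implicit Types (h g : R[i] -> R[i]) (z a c k w : R[i]) (e d : R).

Lemma cderiv_comp h g z c c' : cderiv_at h z c -> cderiv_at g (h z) c' ->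
  cderiv_at (g \o h) z (c' * c).
Proof.
move=> hc gc e e0.
have n0 := normc_ge0 c; have n0' := normc_ge0 c'.
pose e2 := Num.min 1 (e / 2 / (normc c' + 1)).
have e20 : 0 < e2 by rewrite lt_min ltr01 !divr_gt0//; lra.
have [d1 d10 H1] := hc e2 e20.
have e10 : 0 < e / 2 / (normc c + 1) by rewrite !divr_gt0//; lra.
have [d2 d20 H2] := gc _ e10.
have d30 : 0 < d2 / (normc c + 1) by rewrite divr_gt0//; lra.
exists (Num.min d1 (d2 / (normc c + 1))); first by rewrite lt_min d10.
move=> k; rewrite lt_min => /andP[kd1 kd2].
have {}H1 := H1 k kd1.
have nk := normc_ge0 k.
set l := h (z + k) - h z.
have le2 : normc (l - c * k) <= normc k.
  by apply: le_trans H1 _; rewrite ler_piMl// ge_min lexx.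
have le2' : normc (l - c * k) <= e / 2 / (normc c' + 1) * normc k.
  by apply: le_trans H1 _; rewrite ler_wpM2r// ge_min lexx orbT.
have ll : normc l <= (normc c + 1) * normc k.
  rewrite -(subrK (c * k) l); apply: le_trans (le_normcD _ _) _.
  by rewrite normcM mulrDl mul1r addrC lerD2l.
have lz : normc l < d2.
  by apply: le_lt_trans ll _; rewrite mulrC -ltr_pdivlMr//; lra.
have {}H2 := H2 l lz.
have E : h z + l = h (z + k) by rewrite addrC subrK.
rewrite E in H2.
have -> : (g \o h) (z + k) - (g \o h) z - c' * c * k =
   (g (h (z + k)) - g (h z) - c' * l) + c' * (l - c * k) by rewrite /=; ring.
apply: le_trans (le_normcD _ _) _; rewrite normcM.
have A1 : e / 2 / (normc c + 1) * normc l <= e / 2 * normc k.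
  apply: (@le_trans _ _ (e / 2 / (normc c + 1) * ((normc c + 1) * normc k))).
    by rewrite ler_wpM2l// ltW.
  by rewrite mulrA divfK// gt_eqF//; lra.
have A2 : normc c' * normc (l - c * k) <= e / 2 * normc k.
  apply: (@le_trans _ _ ((normc c' + 1) * (e / 2 / (normc c' + 1) * normc k))).
    by apply: ler_pM; rewrite ?normc_ge0//; lra.
  by rewrite mulrA mulrCA divff ?mulr1// gt_eqF//; lra.
by move: (le_trans H2 A1) A2; lra.
Qed.

Definition disc_aut a w := (a - w) / (1 - a^*%C * w).

Lemma disc_aut_denom a w : unit_disc a -> unit_disc w -> 1 - a^*%C * w != 0.
Proof.
rewrite /unit_disc => a1 w1; rewrite subr_eq0; apply/eqP => /(congr1 (@normc R)).
rewrite normc1 normcM normc_conj => /eqP; rewrite gt_eqF//.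
by have := normc_ge0 a; have := normc_ge0 w; nra.
Qed.

Lemma unit_discE z : unit_disc z = (Re z ^+ 2 + Im z ^+ 2 < 1).
Proof.
by rewrite /unit_disc -normc_sq -[X in _ = (_ < X)](expr1n _ 2) ltr_pXn2r// nnegrE ?normc_ge0.
Qed.

Lemma disc_aut_disc a w : unit_disc a -> unit_disc w -> unit_disc (disc_aut a w).
Proof.
move=> a1 w1; rewrite /unit_disc /disc_aut normcM normcV.
have d0 := disc_aut_denom a1 w1.
have dp := normc_gt0 d0.
rewrite ltr_pdivrMr// mul1r -(@ltr_pXn2r _ 2) ?nnegrE ?normc_ge0// !normc_sq.
rewrite !unit_discE in a1 w1; case: a w a1 w1 {d0 dp} => [a b] [x y] /= h1 h2.
rewrite -subr_gt0; have : 0 < (1 - (a ^+ 2 + b ^+ 2)) * (1 - (x ^+ 2 + y ^+ 2)).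
  by rewrite mulr_gt0// subr_gt0.
by congr (0 < _); ring.
Qed.

Lemma cderiv_affine b c z : cderiv_at (fun w => b + c * w) z c.
Proof.
move=> e e0; exists 1 => // k _.
rewrite (_ : _ - _ = 0); last by ring.
by rewrite normc0 mulr_ge0 ?normc_ge0// ltW.
Qed.

Lemma disc_aut_cderiv a w : unit_disc a -> unit_disc w ->
  cderiv_at (disc_aut a) w (- (1 - a^*%C * a) / (1 - a^*%C * w) ^+ 2).
Proof.
move=> a1 w1; have d0 := disc_aut_denom a1 w1.
have E1 : disc_aut a = fun w => (a + -1 * w) / (1 + - a^*%C * w).
  by apply/funext => v; rewrite /disc_aut mulN1r mulNr.
have d0' : 1 + - a^*%C * w != 0 by rewrite mulNr.
have /cderiv_atP h1 := cderiv_affine a (-1) w.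
have /cderiv_atP h2 := cderiv_affine 1 (- a^*%C) w.
have /cderiv_atP := is_derive_quotient h1 h2 d0'.
rewrite E1 (_ : - (1 - a^*%C * a) = -1 * (1 + - a^*%C * w) - (a + -1 * w) * - a^*%C); last by ring.
by rewrite (_ : 1 - a^*%C * w = 1 + - a^*%C * w) ?mulNr.
Qed.

Lemma disc_aut_differentiable a w : unit_disc a -> unit_disc w ->
  differentiable (disc_aut a) w.
Proof. by move=> a1 w1; apply: cderiv_differentiable; exact: disc_aut_cderiv. Qed.

Lemma one_sub_conjM a : 1 - a^*%C * a = (1 - normc a ^+ 2)%:C.
Proof.
by rewrite mulrC mulc_conj rmorphB rmorph1.
Qed.

Lemma unit_disc_gap a : unit_disc a -> 0 < 1 - normc a ^+ 2.
Proof. by move=> a1; rewrite subr_gt0 expr_lt1// normc_ge0. Qed.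

Lemma unit_disc0 : unit_disc (0 : R[i]).
Proof. by rewrite /unit_disc normc0. Qed.

(** Conjugating h by the Moebius maps exchanging z with 0 and h(z) with 0 reduces
to the Schwarz bound at the origin. *)
Lemma schwarz_pick_derivative h z c :
  (forall z, unit_disc z -> differentiable h z) ->
  (forall z, unit_disc z -> unit_disc (h z)) -> unit_disc z -> cderiv_at h z c ->
  normc c * (1 - normc z ^+ 2) <= 1 - normc (h z) ^+ 2.
Proof.
move=> dh hD zD hc.
pose g := disc_aut (h z) \o (h \o disc_aut z).
have M0 : disc_aut z 0 = z by rewrite /disc_aut mulr0 !subr0 divr1.
have g0 : g 0 = 0 by rewrite /g /= M0 /disc_aut subrr mul0r.
have gD w : unit_disc w -> unit_disc (g w).
  by move=> wD; apply: disc_aut_disc; apply: hD => //; apply: disc_aut_disc.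
have dg w : unit_disc w -> differentiable g w.
  move=> wD; have zw := disc_aut_disc zD wD.
  have d1 : differentiable (h \o disc_aut z) w.
    by apply: differentiable_comp (dh _ zw); apply: disc_aut_differentiable.
  by apply: (differentiable_comp d1); apply: disc_aut_differentiable; exact: hD.
have hc' : cderiv_at h (disc_aut z 0) c by rewrite M0.
have h1 := cderiv_comp (disc_aut_cderiv zD unit_disc0) hc'.
have h2 := disc_aut_cderiv (hD _ zD) (hD _ zD).
have E0 : (h \o disc_aut z) 0 = h z by rewrite /= M0.
move: h2; rewrite -[X in cderiv_at _ X _]E0 => h2.
have {h1 h2}h3 := cderiv_comp h1 h2; rewrite -/g in h3.
have := schwarz_derivative dg (fun w wD => ltW (gD w wD)) g0 h3.
rewrite mulr0 subr0 expr1n divr1 !one_sub_conjM.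
have p1 := unit_disc_gap zD; have p2 := unit_disc_gap (hD _ zD).
move: (1 - normc z ^+ 2) (1 - normc (h z) ^+ 2) p1 p2 => q p q0 p0.
rewrite !normcM normcV !normcN -rmorphXn !normc_real normrX !gtr0_norm//.
by rewrite expr2 invfM mulVKf ?gt_eqF// mulrC ler_pdivrMr// mul1r.
Qed.


(** Along the radius through z, the component of h in the direction of h(z)
satisfies the hypotheses of [artanh_comparison], by the infinitesimal
Schwarz-Pick inequality. *)
Lemma schwarz_lemma h z : (forall z, unit_disc z -> differentiable h z) ->
  (forall z, unit_disc z -> unit_disc (h z)) -> h 0 = 0 -> unit_disc z ->
  normc (h z) <= normc z.
Proof.
move=> dh hD h0 zD; have [->|z0] := eqVneq z 0; first by rewrite h0.
have r0 := normc_gt0 z0.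
have [u u1 uc] := rotation_to_Im (h z).
have r1 : normc z < 1 by exact: zD.
set r := normc z in r0 r1 *; pose s := z / r%:C.
have s1 : normc s = 1 by rewrite normcM normcV normc_real gtr0_norm// divff// gt_eqF.
have sr : r%:C * s = z by rewrite mulrCA divff ?mulr1// fmorph_eq0 gt_eqF.
pose v t := - Im (u * h (t%:C * s)).
have tD t : 0 <= t <= r -> unit_disc (t%:C * s).
  move=> tr; rewrite /unit_disc normcM s1 mulr1 normc_real ger0_norm; last by lra.
  lra.
have v_le t : `|v t| <= normc (h (t%:C * s)).
  by rewrite normrN -[X in _ <= X]mul1r -u1 -normcM normr_Im_normc.
have vb t : 0 <= t <= r -> -1 < v t < 1.
  by move=> tr; have := le_lt_trans (v_le t) (hD _ (tD t tr)); rewrite ltr_norml.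
have : v r <= r; last by rewrite /v sr uc.
apply: artanh_comparison => //; [by rewrite r0|by rewrite /v mul0r h0 mulr0 oppr0|].
move=> t tr; have [c hc] := differentiable_cderiv (dh _ (tD t tr)).
exists (- Im (u * (c * s))).
  apply/(is_derive_affine v t) => e e0; have [d d0 H] := hc e e0; exists d => // k kd.
  have := H (k%:C * s); rewrite normcM s1 mulr1 normc_real => /(_ kd).
  rewrite -mulrDl -rmorphD => {}H; apply: le_trans H.
  rewrite -[X in _ <= X]mul1r -u1 -normcM.
  apply: le_trans (normr_Im_normc _); rewrite -normrN le_eqVlt; apply/orP; left.
  apply/eqP; congr `|_|; rewrite /v; clear.
  move: (h _) (h _) => [h1 h2] [h3 h4]; case: u s c => [u1 u2] [s1 s2] [c1 c2] /=; ring.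
have := schwarz_pick_derivative dh hD (tD t tr) hc.
rewrite normcM s1 mulr1 normc_real real_normK ?num_real// => H.
apply: (@le_trans _ _ (1 - normc (h (t%:C * s)) ^+ 2)); last first.
  by rewrite lerD2l lerN2 -real_normK ?num_real// lerXn2r ?nnegrE ?normc_ge0.
apply: le_trans H; rewrite ler_wpM2r//.
  have t1 : t <= 1 by lra.
  by rewrite subr_ge0 expr_le1//; case/andP: tr.
apply: le_trans (ler_norm _) _; rewrite normrN (le_trans (normr_Im_normc _))//.
by rewrite (normcM u) (normcM c) u1 s1 mul1r mulr1.
Qed.

End SchwarzLemma.

(** * The Hermitian product of C^n *)

Section HermitianProduct.
Context {R : realType} {n : nat}.
Local Open Scope complex_scope.
Implicit Types (a b z w : 'rV[R[i]]_n.+1) (c : R[i]).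

Definition cdot z a : R[i] := \sum_j z 0 j * (a 0 j)^*%C.

Definition nsq z : R := \sum_j normc (z 0 j) ^+ 2.

Lemma nsq_ge0 z : 0 <= nsq z.
Proof. by apply: sumr_ge0 => j _; exact: sqr_ge0. Qed.

Lemma enorm_sq z : enorm z ^+ 2 = nsq z.
Proof. by rewrite sqr_sqrtr// nsq_ge0. Qed.

Lemma enorm_ge0 z : 0 <= enorm z.
Proof. exact: sqrtr_ge0. Qed.

Lemma unit_ballE z : unit_ball z <-> nsq z < 1.
Proof.
rewrite /unit_ball /eball /= subr0 -enorm_sq.
rewrite -[X in _ <-> is_true (_ < X)](expr1n _ 2).
by rewrite ltr_pXn2r// nnegrE ?enorm_ge0.
Qed.

Lemma cdotvv z : cdot z z = (nsq z)%:C.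
Proof. by rewrite rmorph_sum /=; apply: eq_bigr => j _; exact: mulc_conj. Qed.

Lemma cdotC z a : cdot z a = (cdot a z)^*%C.
Proof.
rewrite rmorph_sum /=; apply: eq_bigr => j _.
by rewrite rmorphM/= conjcK mulrC.
Qed.

Lemma cdotNr z a : cdot z (- a) = - cdot z a.
Proof. by rewrite /cdot -sumrN; apply: eq_bigr => j _; rewrite mxE rmorphN mulrN. Qed.

Lemma cdotDl z w a : cdot (z + w) a = cdot z a + cdot w a.
Proof. by rewrite -big_split /=; apply: eq_bigr => j _; rewrite mxE mulrDl. Qed.

Lemma cdotZl c z a : cdot (c *: z) a = c * cdot z a.
Proof. by rewrite mulr_sumr; apply: eq_bigr => j _; rewrite mxE mulrA. Qed.

Lemma cdotNl z a : cdot (- z) a = - cdot z a.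
Proof. by rewrite -scaleN1r cdotZl mulN1r. Qed.

Lemma cdotZr c z a : cdot z (c *: a) = c^*%C * cdot z a.
Proof. by rewrite cdotC cdotZl rmorphM/= -cdotC. Qed.

Lemma cdot0l a : cdot 0 a = 0.
Proof. by rewrite -(scale0r (0 : 'rV[R[i]]_n.+1)) cdotZl mul0r. Qed.

Lemma nsqD z w : nsq (z + w) = nsq z + nsq w + 2 * Re (cdot z w).
Proof.
have := cdotvv (z + w); rewrite cdotDl !(cdotC _ (z + w)) !cdotDl !rmorphD /= -!cdotC.
rewrite !cdotvv (cdotC w z) => /(congr1 (@complex.Re R)) /=.
case: (cdot z w) => x y /=; lra.
Qed.

Lemma nsqZ c z : nsq (c *: z) = normc c ^+ 2 * nsq z.
Proof. by rewrite mulr_sumr; apply: eq_bigr => j _; rewrite mxE normcM exprMn. Qed.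

Lemma nsqN z : nsq (- z) = nsq z.
Proof. by apply: eq_bigr => j _; rewrite mxE normcN. Qed.

Lemma enormZ c z : enorm (c *: z) = normc c * enorm z.
Proof.
apply/eqP; rewrite -(eqrXn2 (n:=2))// ?mulr_ge0 ?enorm_ge0 ?normc_ge0//.
by rewrite exprMn !enorm_sq nsqZ.
Qed.

Lemma nsq_eq0 z : nsq z = 0 -> z = 0.
Proof.
move=> /psumr_eq0P H; apply/rowP => j; rewrite mxE; apply: eq0_normc.
by apply/eqP; rewrite -(sqrf_eq0 (normc _)) H// => i _; exact: sqr_ge0.
Qed.

Lemma nsq0 : nsq 0 = 0.
Proof. by rewrite -(scale0r (0 : 'rV[R[i]]_n.+1)) nsqZ normc0 expr0n mul0r. Qed.

Lemma cauchy_schwarz_sq z a : normc (cdot z a) ^+ 2 <= nsq z * nsq a.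
Proof.
have [a0|a0] := eqVneq (nsq a) 0.
  by rewrite (nsq_eq0 a0) cdotC cdot0l conjc0 normc0 expr0n nsq0 mulr0.
have ap : 0 < nsq a by rewrite lt_def a0 nsq_ge0.
have := nsq_ge0 ((nsq a)%:C *: z - cdot z a *: a).
rewrite nsqD nsqN !nsqZ normc_real real_normK ?num_real//.
rewrite cdotNr cdotZr cdotZl; case: (cdot z a) => x y; rewrite normc_sq/= => H.
have : 0 <= nsq a * (nsq z * nsq a - (x ^+ 2 + y ^+ 2)).
  by apply: le_trans H _; rewrite le_eqVlt; apply/orP; left; apply/eqP; ring.
by rewrite pmulr_rge0// subr_ge0.
Qed.

Lemma cauchy_schwarz z a : normc (cdot z a) <= enorm z * enorm a.
Proof.
rewrite -ler_sqr ?nnegrE ?mulr_ge0 ?normc_ge0 ?enorm_ge0// exprMn !enorm_sq.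
exact: cauchy_schwarz_sq.
Qed.

End HermitianProduct.

(** * The involutions of the ball *)

Section BallAutomorphism.
Context {R : realType} {n : nat}.
Local Open Scope complex_scope.
Local Notation V := 'rV[R[i]]_n.+1.
Implicit Types (a b z w : V) (c : R[i]).

Lemma enorm_lt1 z : unit_ball z <-> enorm z < 1.
Proof. by rewrite /unit_ball /eball /= subr0. Qed.

Lemma unit_ball_gap z : unit_ball z -> 0 < 1 - nsq z.
Proof. by move=> /unit_ballE; rewrite subr_gt0. Qed.

Lemma cdot_lt1 z a : unit_ball z -> unit_ball a -> normc (cdot z a) < 1.
Proof.
move=> /enorm_lt1 z1 /enorm_lt1 a1; apply: le_lt_trans (cauchy_schwarz z a) _.
by have := enorm_ge0 z; have := enorm_ge0 a; nra.
Qed.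

Lemma one_sub_cdot_gt0 z a : unit_ball z -> unit_ball a -> 0 < normc (1 - cdot z a).
Proof.
move=> z1 a1; have := le_normcD (1 - cdot z a) (cdot z a); rewrite subrK normc1.
by have := cdot_lt1 z1 a1; lra.
Qed.

Lemma one_sub_cdot_neq0 z a : unit_ball z -> unit_ball a -> 1 - cdot z a != 0.
Proof.
move=> z1 a1; apply/eqP => E; have := one_sub_cdot_gt0 z1 a1.
by rewrite E normc0 ltxx.
Qed.

(** The involution of the ball exchanging a and 0. The usual formula
(a - P z - s Q z) / (1 - <z, a>), where P is the projection on the line of a and
Q = 1 - P, is rewritten with (1 - s) / |a|^2 = 1 / (1 + s), so that a = 0 needs
no separate treatment. *)
Definition ball_invol a z : V :=
  let s := Num.sqrt (1 - nsq a) in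
  (1 - cdot z a)^-1 *: ((1 - cdot z a / (1 + s)%:C) *: a - s%:C *: z).

Lemma ball_invol_nsq a z : unit_ball a -> unit_ball z ->
  normc (1 - cdot z a) ^+ 2 * (1 - nsq (ball_invol a z)) = (1 - nsq a) * (1 - nsq z).
Proof.
move=> a1 z1; have d0 := one_sub_cdot_gt0 z1 a1; have ga := unit_ball_gap a1.
rewrite /ball_invol; set s := Num.sqrt _.
have s0 : 0 <= s by exact: sqrtr_ge0.
have sE : nsq a = 1 - s ^+ 2 by rewrite sqr_sqrtr ?subKr// ltW.
rewrite nsqZ normcV exprVn mulrBr mulr1 mulVKf; last by rewrite expf_neq0// gt_eqF.
rewrite nsqD nsqN !nsqZ normc_real real_normK ?num_real//.
rewrite cdotNr cdotZr cdotZl conjc_real {ga d0} sE.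
have -> : cdot z a / (1 + s)%:C = cdot z a * ((1 + s)^-1)%:C by rewrite fmorphV.
rewrite [cdot a z]cdotC.
case: (cdot z a) => x y; rewrite !normc_sq /=.
have s1 : 1 + s != 0 by rewrite gt_eqF// ltr_pwDl.
by field.
Qed.

Lemma ball_invol_ball a z : unit_ball a -> unit_ball z -> unit_ball (ball_invol a z).
Proof.
move=> a1 z1; apply/unit_ballE; rewrite -subr_gt0.
rewrite -(@pmulr_rgt0 _ (normc (1 - cdot z a) ^+ 2)) ?exprn_gt0 ?one_sub_cdot_gt0//.
by rewrite ball_invol_nsq// mulr_gt0// unit_ball_gap.
Qed.

Lemma ball_invol0 a : ball_invol a 0 = a.
Proof. by rewrite /ball_invol cdot0l mul0r !subr0 invr1 scaler0 subr0 !scale1r. Qed.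

Lemma ball_involK a z : unit_ball a -> unit_ball z -> ball_invol a (ball_invol a z) = z.
Proof.
move=> a1 z1; have d0 := one_sub_cdot_neq0 z1 a1; have ga := unit_ball_gap a1.
rewrite /ball_invol; set s := Num.sqrt _.
have s0 : 0 < s by rewrite sqrtr_gt0.
have sE : nsq a = 1 - s ^+ 2 by rewrite sqr_sqrtr ?subKr// ltW.
have t1E : (1 + s)%:C = 1 + s%:C :> R[i] by rewrite rmorphD rmorph1.
have s1 : 1 + s%:C != 0 :> R[i] by rewrite -t1E fmorph_eq0 gt_eqF// addr_gt0.
have s0' : s%:C != 0 :> R[i] by rewrite fmorph_eq0 gt_eqF.
have t2E : (1 - s ^+ 2)%:C = 1 - s%:C ^+ 2 :> R[i] by rewrite rmorphB rmorph1 rmorphXn.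
rewrite !cdotZl cdotDl cdotNl !cdotZl cdotvv sE t2E t1E.
move: (cdot z a) s%:C d0 s1 s0' => c t d0 s1 s0'.
have -> : 1 - (1 - c)^-1 * ((1 - c / (1 + t)) * (1 - t ^+ 2) - t * c) = t ^+ 2 / (1 - c).
  by field; rewrite d0.
have -> : 1 - (1 - c)^-1 * ((1 - c / (1 + t)) * (1 - t ^+ 2) - t * c) / (1 + t) =
   t * (1 - c / (1 + t)) / (1 - c) by field; rewrite d0.
by apply/rowP => j; rewrite !mxE; field; rewrite d0 s1.
Qed.

Lemma ball_invol_self a : unit_ball a -> ball_invol a a = 0.
Proof. by move=> a1; rewrite -{2}(ball_invol0 a) ball_involK//; apply/unit_ballE; rewrite nsq0. Qed.

Lemma differentiable_cdot a z : differentiable (cdot^~ a) z.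
Proof.
have -> : cdot^~ a = \sum_j (fun z : V => z 0 j * (a 0 j)^*%C).
  by apply/funext => w; rewrite fct_sumE.
apply: differentiable_sum => j.
by apply: differentiableM; [exact: differentiable_coord|exact: differentiable_cst].
Qed.

Lemma differentiable_rowP (U : normedModType R[i]) (F : U -> V) u :
  (forall j, differentiable (fun x => F x 0 j) u) -> differentiable F u.
Proof.
move=> H; have -> : F = \sum_j (fun x => F x 0 j *: (delta_mx 0 j : V)).
  by apply/funext => w; rewrite fct_sumE [LHS]row_sum_delta.
by apply: differentiable_sum => j; exact: differentiableZl.
Qed.

Lemma differentiable_ball_invol a z : unit_ball a -> unit_ball z ->
  differentiable (ball_invol a) z.
Proof.
move=> a1 z1; apply: differentiable_rowP => j.
set s := Num.sqrt (1 - nsq a).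
have -> : (fun w => ball_invol a w 0 j) =
  (fun w => (1 - cdot w a)^-1) * ((fun w => (1 - cdot w a * ((1 + s)%:C)^-1) * a 0 j) -
     (fun w : V => s%:C * w 0 j)).
  by apply/funext => w; rewrite /ball_invol !mxE.
have dc := differentiable_cdot a z.
have dcst c : differentiable (fun _ : V => c) z by exact: differentiable_cst.
have d1 : differentiable (fun w => 1 - cdot w a) z by exact: (differentiableB (dcst 1) dc).
have d2 : differentiable (fun w => 1 - cdot w a * ((1 + s)%:C)^-1) z.
  exact: (differentiableB (dcst 1) (differentiableM dc (dcst _))).
have dz : differentiable (fun w : V => w 0 j) z by exact: differentiable_coord.
apply: differentiableM; first exact: (differentiableV d1 (one_sub_cdot_neq0 z1 a1)).
exact: (differentiableB (differentiableM d2 (dcst _)) (differentiableM (dcst _) dz)).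
Qed.

Lemma ball_invol_holomorphic a : unit_ball a -> holomorphic_self_map (ball_invol a).
Proof.
by move=> a1; split=> z z1; [exact: ball_invol_ball|exact: differentiable_ball_invol].
Qed.

Lemma unit_ball0 : unit_ball (0 : V).
Proof. by apply/unit_ballE; rewrite nsq0. Qed.

End BallAutomorphism.

(** * The Schwarz and Schwarz-Pick lemmas in the ball *)

Section BallSchwarz.
Context {R : realType} {n : nat}.
Local Open Scope complex_scope.
Local Notation V := 'rV[R[i]]_n.+1.
Implicit Types (a b z w : V) (f g T : V -> V).

(** Apply the Schwarz lemma to the function c |-> <g(c u), v>, where u and v are
the unit vectors of z and g(z). *)
Lemma ball_schwarz g z : holomorphic_self_map g -> g 0 = 0 -> unit_ball z ->
  enorm (g z) <= enorm z.
Proof.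
move=> [gB dg] g0 z1.
have [->|gz0] := eqVneq (g z) 0.
  by rewrite /enorm (_ : \sum_j _ = 0) ?sqrtr0 ?sqrtr_ge0//; exact: nsq0.
have z0 : z != 0 by apply: contra gz0 => /eqP ->; rewrite g0.
have pos w : w != 0 -> 0 < enorm w.
  move=> w0; rewrite lt_def enorm_ge0 andbT; apply: contra w0 => /eqP w0.
  by apply/eqP/nsq_eq0; rewrite -enorm_sq w0 expr0n.
have unitize w : w != 0 -> exists2 u : V, enorm u = 1 & w = (enorm w)%:C *: u.
  move=> w0; exists (((enorm w)^-1)%:C *: w).
    by rewrite enormZ normc_real ger0_norm ?invr_ge0 ?enorm_ge0// mulVf// gt_eqF// pos.
  by rewrite scalerA -rmorphM mulfV ?scale1r// gt_eqF// pos.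
have [u u1 zE] := unitize z z0; have [v v1 gzE] := unitize (g z) gz0.
have lineB (c : R[i]) : unit_disc c -> unit_ball (c *: u).
  by move=> c1; apply/enorm_lt1; rewrite enormZ u1 mulr1.
pose h (c : R[i]) := cdot (g (c *: u)) v.
have h0 : h 0 = 0 by rewrite /h scale0r g0 cdot0l.
have hz : h (enorm z)%:C = (enorm (g z))%:C.
  by rewrite /h -zE {1}gzE cdotZl cdotvv -enorm_sq v1 expr1n mulr1.
have hD c : unit_disc c -> unit_disc (h c).
  move=> /lineB/gB/enorm_lt1 lt; apply: le_lt_trans lt.
  by rewrite /h (le_trans (cauchy_schwarz _ _))// v1 mulr1.
have dh c : unit_disc c -> differentiable h c.
  move=> c1; have dl : differentiable (fun c : R[i] => c *: u) c.
    by apply: differentiableZl.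
  have dgl := differentiable_comp dl (dg _ (lineB c c1)).
  exact: (differentiable_comp dgl (differentiable_cdot v (g (c *: u)))).
have zD : unit_disc (enorm z)%:C.
  by rewrite /unit_disc normc_real ger0_norm ?enorm_ge0//; apply/enorm_lt1.
have := schwarz_lemma dh hD h0 zD.
by rewrite hz !normc_real !ger0_norm ?enorm_ge0.
Qed.

Lemma holomorphic_comp f g : holomorphic_self_map f -> holomorphic_self_map g ->
  holomorphic_self_map (g \o f).
Proof.
move=> [fB df] [gB dg]; split=> z z1 /=; first by apply: gB; exact: fB.
exact: (differentiable_comp (df _ z1) (dg _ (fB _ z1))).
Qed.

(** Two automorphisms sending a to 0 differ by an automorphism fixing 0, which
preserves the norm by the Schwarz lemma applied to it and to its inverse. So
the automorphism selected by choice may be replaced by the explicit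
involution. *)
Lemma enorm_ball_aut a b : unit_ball a -> unit_ball b ->
  enorm (ball_aut a b) = enorm (ball_invol a b).
Proof.
move=> a1 b1.
have Ja := ball_invol_holomorphic a1.
have Jx : [set T | ball_automorphism T /\ T a = 0] (ball_invol a).
  split; last exact: ball_invol_self.
  by exists (ball_invol a); split => // z z1; exact: ball_involK.
have := @xgetPex _ (idfun : V -> V) _ (ex_intro _ _ Jx); rewrite -/(ball_aut a).
set T := ball_aut a => -[[T' [hT hT' T'T TT']] Ta].
apply/eqP; rewrite eq_le; apply/andP; split.
- have h0 : (T \o ball_invol a) 0 = 0 by rewrite /= ball_invol0.
  have := ball_schwarz (holomorphic_comp Ja hT) h0 (ball_invol_ball a1 b1).
  by rewrite /= ball_involK.
- have h0 : (ball_invol a \o T') 0 = 0 by rewrite /= -{1}Ta T'T// ball_invol_self.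
  have := ball_schwarz (holomorphic_comp hT' Ja) h0 (hT.1 _ b1).
  by rewrite /= T'T.
Qed.

(** The pseudo-hyperbolic distance of the ball. *)
Definition pdist a b : R := enorm (ball_invol a b).

Lemma pdist_lt1 a b : unit_ball a -> unit_ball b -> pdist a b < 1.
Proof. by move=> a1 b1; apply/enorm_lt1; exact: ball_invol_ball. Qed.

Lemma pdist_gap a b : unit_ball a -> unit_ball b ->
  normc (1 - cdot b a) ^+ 2 * (1 - pdist a b ^+ 2) = (1 - nsq a) * (1 - nsq b).
Proof. by move=> a1 b1; rewrite /pdist enorm_sq ball_invol_nsq. Qed.

Lemma pdist_schwarz_pick f a b : holomorphic_self_map f -> unit_ball a -> unit_ball b ->
  pdist (f a) (f b) <= pdist a b.
Proof.
move=> hf a1 b1; have fa1 := hf.1 _ a1.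
have hg := holomorphic_comp (holomorphic_comp (ball_invol_holomorphic a1) hf)
  (ball_invol_holomorphic fa1).
have h0 : (ball_invol (f a) \o (f \o ball_invol a)) 0 = 0.
  by rewrite /= ball_invol0 ball_invol_self.
have := ball_schwarz hg h0 (ball_invol_ball a1 b1).
by rewrite /= ball_involK.
Qed.

Lemma ball_schwarz_pick f a b : holomorphic_self_map f -> unit_ball a -> unit_ball b ->
  normc (1 - cdot (f b) (f a)) ^+ 2 * ((1 - nsq a) * (1 - nsq b)) <=
  normc (1 - cdot b a) ^+ 2 * ((1 - nsq (f a)) * (1 - nsq (f b))).
Proof.
move=> hf a1 b1; have fa1 := hf.1 _ a1; have fb1 := hf.1 _ b1.
have le := pdist_schwarz_pick hf a1 b1.
have q0 : 0 <= pdist (f a) (f b) by exact: enorm_ge0.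
rewrite -(pdist_gap a1 b1) -(pdist_gap fa1 fb1).
move: (normc _) (normc _) (pdist _ _) (pdist _ _) le q0 => D' D q p qp q0.
rewrite mulrCA ler_wpM2l ?sqr_ge0// ler_wpM2l ?sqr_ge0// lerD2l lerN2.
by rewrite lerXn2r// nnegrE (le_trans q0).
Qed.

Lemma pdistC a b : unit_ball a -> unit_ball b -> pdist a b = pdist b a.
Proof.
move=> a1 b1; have E1 := pdist_gap a1 b1; have E2 := pdist_gap b1 a1.
have E : normc (1 - cdot b a) = normc (1 - cdot a b).
  by rewrite (cdotC b) -[RHS]normc_conj rmorphB rmorph1.
have D0 := one_sub_cdot_gt0 a1 b1.
have p0 : 0 <= pdist a b by exact: enorm_ge0.
have q0 : 0 <= pdist b a by exact: enorm_ge0.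
move: E1; rewrite (mulrC (1 - nsq a)) -E2 E {E E2}.
move: (normc _) (pdist a b) (pdist b a) D0 p0 q0 => D p q D0 p0 q0 H.
have {}H : p ^+ 2 = q ^+ 2.
  by apply/oppr_inj/(addrI 1)/(mulfI _ H); rewrite expf_neq0// gt_eqF.
by apply/eqP; rewrite -(eqrXn2 (n:=2))// H.
Qed.

(** By invariance one may take c = 0; then the formula for the gap and the bound
|1 - <y, x>| <= 1 + |x| |y| give the addition formula of the hyperbolic
tangent. *)
Lemma pdist_triangle a b c : unit_ball a -> unit_ball b -> unit_ball c ->
  pdist a b <= (pdist a c + pdist c b) / (1 + pdist a c * pdist c b).
Proof.
move=> a1 b1 c1.
have x1 := ball_invol_ball c1 a1; have y1 := ball_invol_ball c1 b1.
have := pdist_schwarz_pick (ball_invol_holomorphic c1) x1 y1.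
rewrite !ball_involK// => /le_trans; apply.
rewrite (pdistC a1 c1).
have := pdist_gap x1 y1; have C := cauchy_schwarz (ball_invol c b) (ball_invol c a).
have P := pdist_lt1 x1 y1.
move: P C; rewrite -!enorm_sq -/(pdist c a) -/(pdist c b).
have X0 : 0 <= pdist c a by exact: enorm_ge0.
have X1 := pdist_lt1 c1 a1.
have Y0 : 0 <= pdist c b by exact: enorm_ge0.
have Y1 := pdist_lt1 c1 b1.
have Z0 : 0 <= pdist (ball_invol c a) (ball_invol c b) by exact: enorm_ge0.
have T : normc (1 - cdot (ball_invol c b) (ball_invol c a)) <=
   1 + normc (cdot (ball_invol c b) (ball_invol c a)).
  by rewrite (le_trans (le_normcD _ _))// normc1 normcN.
have T0 := normc_ge0 (1 - cdot (ball_invol c b) (ball_invol c a)).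
move: T T0 Z0; move: (pdist (ball_invol c a) (ball_invol c b)) => Z.
move: (normc (1 - _)) (normc (cdot _ _)) => D C T T0 Z0 Z1 CXY.
move: (pdist c a) (pdist c b) X0 X1 Y0 Y1 CXY => X Y X0 X1 Y0 Y1 CXY E.
have XY0 : 0 <= X * Y by rewrite mulr_ge0.
have p0 : 0 < 1 + X * Y by lra.
have ZXY0 : 0 <= Z * (1 + X * Y) by rewrite mulr_ge0// ltW.
rewrite ler_pdivlMr// -(@ler_pXn2r _ 2) ?nnegrE ?addr_ge0//.
have h1 : D ^+ 2 <= (1 + X * Y) ^+ 2.
  by rewrite lerXn2r// ?nnegrE; lra.
have h2 : D ^+ 2 * (1 - Z ^+ 2) <= (1 + X * Y) ^+ 2 * (1 - Z ^+ 2).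
  by rewrite ler_wpM2r// subr_ge0 expr_le1// ltW.
rewrite exprMn; move: h2; rewrite {}E; lra.
Qed.

End BallSchwarz.

(** * The Kobayashi distance and the half plane *)

Section KobayashiDistance.
Context {R : realType} {n : nat}.
Local Notation V := 'rV[R[i]%C]_n.+1.
Implicit Types (a b c : V).

Lemma kobayashiE a b : unit_ball a -> unit_ball b ->
  kobayashi a b = 2^-1 * ln ((1 + pdist a b) / (1 - pdist a b)).
Proof. by move=> a1 b1; rewrite /kobayashi enorm_ball_aut. Qed.

Lemma kobayashi_triangle a b c : unit_ball a -> unit_ball b -> unit_ball c ->
  kobayashi a b <= kobayashi a c + kobayashi c b.
Proof.
move=> a1 b1 c1; rewrite !kobayashiE// -mulrDr ler_pM2l ?invr_gt0//.
have := pdist_triangle a1 b1 c1.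
have := pdist_lt1 a1 b1; have := pdist_lt1 a1 c1; have := pdist_lt1 c1 b1.
have : 0 <= pdist a b by exact: enorm_ge0.
have : 0 <= pdist a c by exact: enorm_ge0.
have : 0 <= pdist c b by exact: enorm_ge0.
move: (pdist a b) (pdist a c) (pdist c b) => p x y y0 x0 p0 y1 x1 p1.
have xy0 : 0 <= x * y by rewrite mulr_ge0.
rewrite ler_pdivlMr; last by lra.
move=> H; rewrite -lnM ?posrE ?divr_gt0//; try lra.
rewrite ler_ln ?posrE ?mulr_gt0 ?invr_gt0//; try lra.
rewrite mulf_div ler_pdivrMr; last by lra.
rewrite mulrAC ler_pdivlMr; last by rewrite mulr_gt0//; lra.
nra.
Qed.

Lemma kobayashi_small (eps : R) : 0 < eps -> exists2 eta : R, 0 < eta &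
  forall a b, unit_ball a -> unit_ball b -> pdist a b < eta -> kobayashi a b < eps.
Proof.
move=> e0; pose E := expR (2 * eps).
have E1 : 1 < E by rewrite expR_gt1 mulr_gt0.
exists ((E - 1) / (E + 1)); first by rewrite divr_gt0//; lra.
move=> a b a1 b1; rewrite kobayashiE//.
have := pdist_lt1 a1 b1; have : 0 <= pdist a b by exact: enorm_ge0.
move: (pdist a b) => p p0 p1; rewrite ltr_pdivlMr; last by lra.
move=> H; have Q0 : 0 < (1 + p) / (1 - p) by rewrite divr_gt0//; lra.
rewrite -(@ltr_pM2l _ 2)// mulrA divff// mul1r -ltr_expR lnK// -/E ltr_pdivrMr; lra.
Qed.

End KobayashiDistance.

Section HalfPlane.
Context {R : realType}.
Local Open Scope complex_scope.
Implicit Types (a w z : R[i]).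

Definition half_plane w := 0 < Re w.

Lemma homography_differentiable (p q r s z : R[i]) : r + s * z != 0 ->
  differentiable (fun w => (p + q * w) / (r + s * w)) z.
Proof.
move=> d0; have /cderiv_atP h1 := cderiv_affine p q z.
have /cderiv_atP h2 := cderiv_affine r s z.
have /cderiv_atP := is_derive_quotient h1 h2 d0; exact: cderiv_differentiable.
Qed.

(** The Cayley transform of the half plane Re w > 0 sending a to 0; for a = 1 its
inverse is (1 + z) / (1 - z). *)
Definition half_plane_to_disc a w := (w - a) / (w + a^*%C).
Definition disc_to_half_plane a z := (a + a^*%C * z) / (1 - z).

Lemma half_plane_denom a w : half_plane a -> half_plane w -> w + a^*%C != 0.
Proof.
rewrite /half_plane; case: a w => [a a'] [w w'] /= a0 w0; rewrite eq_complex /= negb_and.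
by rewrite gt_eqF// addr_gt0.
Qed.

Lemma half_plane_to_disc_gap a w : half_plane a -> half_plane w ->
  normc (w + a^*%C) ^+ 2 * (1 - normc (half_plane_to_disc a w) ^+ 2) = 4 * (Re a * Re w).
Proof.
move=> a0 w0; have d0 := normc_gt0 (half_plane_denom a0 w0).
rewrite /half_plane_to_disc normcM normcV exprMn exprVn mulrBr mulr1 mulrCA mulfV; last first.
  by rewrite expf_neq0// gt_eqF.
rewrite mulr1 !normc_sq; case: a w {a0 w0 d0} => [a a'] [w w'] /=; ring.
Qed.

Lemma half_plane_to_discP a w : half_plane a -> half_plane w ->
  unit_disc (half_plane_to_disc a w).
Proof.
move=> a0 w0; have d0 := normc_gt0 (half_plane_denom a0 w0).
rewrite /unit_disc -(@expr_lt1 _ 2)// ?normc_ge0// -subr_gt0.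
rewrite -(@pmulr_rgt0 _ (normc (w + a^*%C) ^+ 2)) ?exprn_gt0//.
by rewrite half_plane_to_disc_gap// !mulr_gt0.
Qed.

Lemma disc_denom z : unit_disc z -> 1 - z != 0.
Proof.
by move=> z1; rewrite subr_eq0; apply/eqP => E; move: z1; rewrite /unit_disc -E normc1 ltxx.
Qed.

Lemma Re_div z w : w != 0 -> Re (z / w) * normc w ^+ 2 = Re (z * w^*%C).
Proof.
move=> w0; have -> : Re (z / w) * normc w ^+ 2 = Re (z / w * (normc w ^+ 2)%:C).
  by case: (z / w) => x y /=; rewrite mulr0 subr0.
by rewrite -mulc_conj mulrA divfK.
Qed.

Lemma Re_disc_to_half_plane a z : unit_disc z ->
  Re (disc_to_half_plane a z) * normc (1 - z) ^+ 2 = Re a * (1 - normc z ^+ 2).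
Proof.
move=> z1; rewrite /disc_to_half_plane Re_div ?disc_denom// normc_sq.
by case: a z {z1} => [a a'] [x y] /=; ring.
Qed.

Lemma disc_to_half_planeP a z : half_plane a -> unit_disc z ->
  half_plane (disc_to_half_plane a z).
Proof.
move=> a0 z1; have d0 := normc_gt0 (disc_denom z1).
rewrite /half_plane -(@pmulr_lgt0 _ (normc (1 - z) ^+ 2)) ?exprn_gt0//.
by rewrite Re_disc_to_half_plane// mulr_gt0// unit_disc_gap.
Qed.

Lemma Re_neq0 z : Re z != 0 -> z != 0.
Proof. by apply: contra => /eqP ->. Qed.

Lemma half_plane_to_discK a w : half_plane a -> half_plane w ->
  disc_to_half_plane a (half_plane_to_disc a w) = w.
Proof.
move=> a0 w0; have d0 := half_plane_denom a0 w0.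
have a2 : a + a^*%C != 0.
  by apply: Re_neq0; case: a a0 {d0} => x y; rewrite /half_plane/= => x0; lra.
rewrite /disc_to_half_plane /half_plane_to_disc.
move: a^*%C d0 a2 => b d0 a2; have -> : 1 - (w - a) / (w + b) = (a + b) / (w + b).
  by field.
by field; rewrite d0 a2.
Qed.

Lemma disc_to_half_planeK a z : half_plane a -> unit_disc z ->
  half_plane_to_disc a (disc_to_half_plane a z) = z.
Proof.
move=> a0 z1; have d0 := disc_denom z1.
have a2 : a + a^*%C != 0.
  by apply: Re_neq0; case: a a0 => x y; rewrite /half_plane/= => x0; lra.
rewrite /disc_to_half_plane /half_plane_to_disc.
move: a^*%C a2 => b a2.
have -> : (a + b * z) / (1 - z) + b = (a + b) / (1 - z) by field.
by field; rewrite d0 a2.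
Qed.

Lemma half_plane_to_disc_differentiable a w : half_plane a -> half_plane w ->
  differentiable (half_plane_to_disc a) w.
Proof.
move=> a0 w0; have -> : half_plane_to_disc a = fun w => (- a + 1 * w) / (a^*%C + 1 * w).
  by apply/funext => v; rewrite !mul1r (addrC (- a)) (addrC a^*%C).
by apply: homography_differentiable; rewrite mul1r addrC half_plane_denom.
Qed.

Lemma disc_to_half_plane_differentiable a z : unit_disc z ->
  differentiable (disc_to_half_plane a) z.
Proof.
move=> z1; have -> : disc_to_half_plane a = fun z => (a + a^*%C * z) / (1 + (-1) * z).
  by apply/funext => v; rewrite mulN1r.
by apply: homography_differentiable; rewrite mulN1r disc_denom.
Qed.

(** The Schwarz lemma for G conjugated by the Cayley transforms centred at a and at
G(a). In this form, quadratic in G(w), the inequality bounds |G(w)| in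
terms of Re (G a) / Re a. *)
Theorem half_plane_schwarz_pick (G : R[i] -> R[i]) a w :
  (forall w, half_plane w -> differentiable G w) ->
  (forall w, half_plane w -> half_plane (G w)) -> half_plane a -> half_plane w ->
  normc (G w + (G a)^*%C) ^+ 2 * (Re a * Re w) <=
  normc (w + a^*%C) ^+ 2 * (Re (G a) * Re (G w)).
Proof.
move=> dG GH a0 w0; have ga0 := GH _ a0; have gw0 := GH _ w0.
pose h := half_plane_to_disc (G a) \o (G \o disc_to_half_plane a).
have hD z : unit_disc z -> unit_disc (h z).
  by move=> z1; apply: half_plane_to_discP => //; apply: GH; exact: disc_to_half_planeP.
have dh z : unit_disc z -> differentiable h z.
  move=> z1; have z0 := disc_to_half_planeP a0 z1.
  have d1 := differentiable_comp (disc_to_half_plane_differentiable a z1) (dG _ z0).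
  exact: (differentiable_comp d1 (half_plane_to_disc_differentiable ga0 (GH _ z0))).
have h0 : h 0 = 0.
  by rewrite /h /= /disc_to_half_plane mulr0 addr0 subr0 divr1 /half_plane_to_disc subrr mul0r.
have := schwarz_lemma dh hD h0 (half_plane_to_discP a0 w0).
rewrite /h /= half_plane_to_discK// => le.
have E1 := half_plane_to_disc_gap ga0 gw0; have E2 := half_plane_to_disc_gap a0 w0.
move: E1 E2 le; rewrite /half_plane in a0 w0 ga0 gw0.
have := normc_ge0 (half_plane_to_disc (G a) (G w)).
move: (normc (half_plane_to_disc _ _)) (normc (half_plane_to_disc _ _)) => q p.
have := sqr_ge0 (normc (G w + (G a)^*%C)); have := sqr_ge0 (normc (w + a^*%C)).
move: (_ ^+ 2) (_ ^+ 2) => D D' D0 D'0 q0 E1 E2 qp.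
have -> : Re a * Re w = D' * (1 - q ^+ 2) / 4 by rewrite E2; field.
have -> : Re (G a) * Re (G w) = D * (1 - p ^+ 2) / 4 by rewrite E1; field.
rewrite -!mulrA mulrCA; apply: ler_wpM2l => //; apply: ler_wpM2l => //.
rewrite ler_pM2r ?invr_gt0// lerD2l lerN2 lerXn2r// nnegrE.
exact: le_trans q0 qp.
Qed.

End HalfPlane.

(** * Euclidean neighbourhoods of e_1 and the liminf *)

Section EuclideanTopology.
Context {R : realType} {n : nat}.
Local Open Scope complex_scope.
Local Notation V := 'rV[R[i]]_n.+1.
Implicit Types (a b z : V).

Lemma normc_coord_le z j : normc (z 0 j) <= enorm z.
Proof.
rewrite -ler_sqr ?nnegrE ?normc_ge0 ?enorm_ge0// enorm_sq /nsq (bigD1 j)//= lerDl.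
by apply: sumr_ge0 => i _; exact: sqr_ge0.
Qed.

Lemma enorm_le_sum z : enorm z <= \sum_j normc (z 0 j).
Proof.
have s0 : 0 <= \sum_j normc (z 0 j) by apply: sumr_ge0 => i _; exact: normc_ge0.
rewrite -ler_sqr ?nnegrE ?enorm_ge0// enorm_sq /nsq expr2 mulr_suml.
apply: ler_sum => j _; rewrite expr2 ler_wpM2l ?normc_ge0//.
rewrite (bigD1 j)//= lerDl; by apply: sumr_ge0 => i _; exact: normc_ge0.
Qed.

Lemma nbhs_enorm a (P : set V) :
  nbhs a P <-> exists2 d : R, 0 < d & forall z, enorm (z - a) < d -> P z.
Proof.
split.
  move=> /nbhs_ballP[[d d'] /=]; rewrite ltcE/= => /andP[/eqP -> d0] H.
  exists d => // z zd; apply: H; split; first by rewrite ltcE/= eqxx.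
  move=> i j; rewrite ord1 /ball/= normCE ltcR -normcN opprB.
  by apply: le_lt_trans zd; have := normc_coord_le (z - a) j; rewrite !mxE.
move=> [d d0 H]; apply/nbhs_ballP; exists (d / 2 / n.+1%:R)%:C => /=.
  by rewrite ltcR !divr_gt0.
move=> z [_ zd]; apply: H; apply: le_lt_trans (enorm_le_sum _) _.
have : \sum_(j < n.+1) normc ((z - a) 0 j) <= \sum_(j < n.+1) d / 2 / n.+1%:R.
  apply: ler_sum => j _; apply: ltW.
  by have := zd 0 j; rewrite /ball/= normCE ltcR -normcN opprB !mxE.
rewrite sumr_const card_ord -[X in _ <= X]mulr_natr divfK ?pnatr_eq0//; lra.
Qed.

Lemma enormD a b : enorm (a + b) <= enorm a + enorm b.
Proof.
rewrite -ler_sqr ?nnegrE ?addr_ge0 ?enorm_ge0// enorm_sq nsqD sqrrD !enorm_sq.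
have := cauchy_schwarz a b; have := le_trans (ler_norm _) (normr_Re_normc (cdot a b)).
by move=> h1 h2; have := le_trans h1 h2; lra.
Qed.

Lemma enormN a : enorm (- a) = enorm a.
Proof. by rewrite /enorm -!/(nsq _) nsqN. Qed.

Lemma cdot_e1 z : cdot z e1 = z 0 0.
Proof.
rewrite /cdot (bigD1 0)//= /e1 mxE !eqxx conjc1 mulr1 big1 ?addr0// => j j0.
by rewrite mxE eqxx (negPf j0) conjc0 mulr0.
Qed.

Lemma nsq_e1 : nsq (e1 : V) = 1.
Proof.
have := cdotvv (e1 : V); rewrite cdot_e1 /e1 mxE !eqxx => /(congr1 (@complex.Re R)) /=.
by move=> <-.
Qed.

Lemma enorm_e1 : enorm (e1 : V) = 1.
Proof. by apply/eqP; rewrite -(eqrXn2 (n:=2)) ?enorm_ge0// enorm_sq nsq_e1 expr1n. Qed.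

Lemma cdot_sub_e1_le a z : normc (cdot z a - z 0 0) <= enorm z * enorm (a - e1).
Proof.
have -> : cdot z a - z 0 0 = cdot z (a - e1).
  by rewrite cdotC -cdot_e1 (cdotC z e1) -rmorphB (cdotC z) cdotDl cdotNl.
exact: cauchy_schwarz.
Qed.

Lemma one_sub_coord_le z : normc (1 - z 0 0) <= enorm (z - e1).
Proof.
have := normc_coord_le (z - e1) 0; rewrite /e1 !mxE !eqxx /=.
by rewrite -normcN opprB.
Qed.

Lemma enorm_sub_e1_sq z : unit_ball z -> enorm (z - e1) ^+ 2 <= 2 * normc (1 - z 0 0).
Proof.
move=> /unit_ballE z1; rewrite enorm_sq nsqD nsqN nsq_e1 cdotNr cdot_e1.
have := le_trans (ler_norm _) (normr_Re_normc (1 - z 0 0)).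
by case: (z 0 0) => x y /=; lra.
Qed.

(** A liminf which is bounded below by a real constant and is not +oo is a real
number; both halves of its definition are extracted, one being used for the
Julia inequality and the other for its sharpness. *)
Lemma liminf_real (X : V -> R) (c : R) : (forall z, unit_ball z -> c <= X z) ->
  (limf_einf (fun z => (X z)%:E) (within unit_ball (nbhs e1)) < +oo)%E ->
  exists al : R, [/\ c <= al,
    (forall e d : R, 0 < e -> 0 < d -> exists z : V,
       [/\ unit_ball z, enorm (z - e1) < d & X z < al + e]) &
    (forall e : R, 0 < e -> exists2 d : R, 0 < d & forall z, unit_ball z ->
       enorm (z - e1) < d -> al - e < X z)].
Proof.
move=> cX; rewrite limf_einfE; set S := [set _ | _ in _] => Soo.
have near_ball (d : R) : 0 < d -> within unit_ball (nbhs e1)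
    [set z : V | unit_ball z /\ enorm (z - e1) < d].
  by move=> d0; apply/nbhs_enorm; exists d.
have cS : (c%:E <= ereal_sup S)%E.
  apply: le_trans (ereal_sup_ubound (ex_intro2 _ _ _ (near_ball 1 ltr01) erefl)).
  by apply: le_ereal_inf_tmp => _ [z [z1 _] <-]; rewrite lee_fin cX.
have [al alE] : exists al : R, ereal_sup S = al%:E.
  by move: cS Soo; case: (ereal_sup S) => [r| |]//; exists r.
exists al; split; first by rewrite -lee_fin -alE.
- move=> e d e0 d0; apply: contrapT => /forallNP H.
  suff : ((al + e)%:E <= al%:E)%E by rewrite lee_fin; lra.
  rewrite -[in X in (_ <= X)%E]alE.
  apply: le_trans (ereal_sup_ubound (ex_intro2 _ _ _ (near_ball d d0) erefl)).
  apply: le_ereal_inf_tmp => _ [z [z1 zd] <-]; rewrite lee_fin leNgt; apply/negP => lt.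
  by apply: (H z).
- move=> e e0; have : ((al - e)%:E < ereal_sup S)%E by rewrite alE lte_fin; lra.
  move=> /ereal_sup_gt[_ [P nP <-] lt]; have [d d0 H] := (nbhs_enorm _ _).1 nP.
  exists d => // z z1 zd; rewrite -lte_fin; apply: lt_le_trans lt _.
  by apply: ereal_inf_lbound; exists z => //; exact: H.
Qed.

End EuclideanTopology.

(** * The Julia inequality *)

Section Julia.
Context {R : realType} {n : nat}.
Local Open Scope complex_scope.
Local Notation V := 'rV[R[i]]_n.+1.
Implicit Types (a b z : V) (f : V -> V).

Lemma pdist0r a : unit_ball a -> pdist a 0 = enorm a.
Proof. by move=> a1; rewrite /pdist ball_invol0. Qed.

(** From the triangle inequality between f(z), f(0) and 0, and
pdist (f z) (f 0) <= |z|. This is what makes the liminf positive. *)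
Lemma dilation_quotient_ge f z : holomorphic_self_map f -> unit_ball z ->
  (1 - enorm (f 0)) / 2 <= (1 - enorm (f z)) / (1 - enorm z).
Proof.
move=> hf z1; have o1 := @unit_ball0 R n; have f01 := hf.1 _ o1; have fz1 := hf.1 _ z1.
have := pdist_triangle fz1 o1 f01; rewrite !pdist0r//.
have := pdist_schwarz_pick hf z1 o1; rewrite pdist0r//.
have p0 : 0 <= pdist (f z) (f 0) by exact: enorm_ge0.
move: z1 fz1 f01 => /enorm_lt1 + /enorm_lt1 + /enorm_lt1.
have := enorm_ge0 z; have := enorm_ge0 (f z); have := enorm_ge0 (f 0).
move: (enorm z) (enorm (f z)) (enorm (f 0)) (pdist _ _) p0 => x y y0 p p0 h1 h2 h3 x1 y1 y01 px.
have py : 0 <= p * y0 by rewrite mulr_ge0.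
rewrite ler_pdivlMr; last by lra.
move=> H; rewrite ler_pdivlMr; last by lra.
have h4 : 0 <= (x - p) * (1 - y0) by rewrite mulr_ge0// subr_ge0// ltW.
have h5 : 0 <= (1 - y) * (1 - p * y0) by rewrite mulr_ge0// subr_ge0; nra.
nra.
Qed.

Lemma radial_limit f : f (r%:C *: e1) @[r --> (1 : R)^'-] --> e1 ->
  forall e : R, 0 < e -> exists2 d : R, 0 < d &
    forall r : R, 1 - d < r < 1 -> enorm (f (r%:C *: e1) - e1) < e.
Proof.
move=> H e e0; have : nbhs e1 [set z : V | enorm (z - e1) < e] by apply/nbhs_enorm; exists e.
move=> /H; rewrite /= /nbhs /= => /nbhs_ballP[d /= d0 Hd]; exists d => // r rd.
by apply: Hd; [rewrite /ball/= ger0_norm; lra|lra].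
Qed.

Lemma real_scale_e1_ball (r : R) : 0 <= r < 1 -> unit_ball (r%:C *: (e1 : V)).
Proof.
by move=> /andP[r0 r1]; apply/enorm_lt1; rewrite enormZ enorm_e1 mulr1 normc_real ger0_norm.
Qed.

Lemma one_sub_nsq z : 1 - nsq z = (1 - enorm z) * (1 + enorm z).
Proof. by rewrite -enorm_sq; ring. Qed.

(** Points z near e_1 with bounded quotient are mapped near e_1: by Schwarz-Pick
between z and a = (1 - s) e_1, |1 - <f(z), f(a)>|^2 is at most a constant times
s, and f(a) is close to e_1 for small s because e_1 is the radial limit. So the
horospheres of the Julia inequality are centred at e_1 in the target too. *)
Lemma bounded_quotient_limit f (K : R) : holomorphic_self_map f ->
  f (r%:C *: e1) @[r --> (1 : R)^'-] --> e1 -> 0 < K ->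
  forall e : R, 0 < e -> exists2 d : R, 0 < d & forall z, unit_ball z ->
    enorm (z - e1) < d -> (1 - enorm (f z)) / (1 - enorm z) < K ->
    enorm (f z - e1) < e.
Proof.
move=> hf /radial_limit rl K0 e e0.
(* |f(z) - e_1|^2 <= 2 |1 - f_1(z)| and |1 - f_1(z)| will be less than 2 m. *)
pose m := Num.min 1 (e ^+ 2 / 8).
have m0 : 0 < m by rewrite lt_min ltr01 divr_gt0// exprn_gt0.
have m1 : m <= 1 by rewrite ge_min lexx.
have me : m <= e ^+ 2 / 8 by rewrite ge_min lexx orbT.
clearbody m.
have [d1 d10 Hd1] := rl m m0.
(* s (8 K) <= m^2 turns the Schwarz-Pick bound into |1 - <f z, f a>| <= m. *)
have [s [s0 sd1 s2 sK]] : exists s, [/\ 0 < s, s <= d1 / 2, s <= 2^-1 & s * (8 * K) <= m ^+ 2].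
  have mK0 : 0 < m ^+ 2 / (8 * K) by rewrite divr_gt0 ?exprn_gt0 ?mulr_gt0.
  exists (Num.min (Num.min (d1 / 2) 2^-1) (m ^+ 2 / (8 * K))); split.
  - by rewrite !lt_min mK0 invr_gt0 ltr0n divr_gt0.
  - by rewrite !ge_min lexx.
  - by rewrite !ge_min lexx orbT.
  - by rewrite -ler_pdivlMr ?mulr_gt0// !ge_min lexx !orbT.
exists s => // z z1 zs zK.
have r01 : 0 <= 1 - s < 1 by lra.
have a1 := real_scale_e1_ball r01; set a := _ *: _ in a1.
have fa : enorm (f a - e1) < m by apply: Hd1; lra.
have fz1 := hf.1 _ z1; have fa1 := hf.1 _ a1.
have SP := ball_schwarz_pick hf a1 z1.
have aN : nsq a = (1 - s) ^+ 2.
  by rewrite nsqZ nsq_e1 mulr1 normc_real real_normK ?num_real.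
have za : normc (1 - cdot z a) <= 2 * s.
  rewrite cdotZr conjc_real cdot_e1.
  have -> : 1 - (1 - s)%:C * z 0 0 = s%:C + (1 - s)%:C * (1 - z 0 0).
    by rewrite rmorphB rmorph1; ring.
  apply: le_trans (le_normcD _ _) _; rewrite normcM !normc_real.
  rewrite (ger0_norm (ltW s0)) ger0_norm; last by lra.
  have := one_sub_coord_le z; have := normc_ge0 (1 - z 0 0); nra.
have D : normc (1 - cdot (f z) (f a)) <= m.
  have N0 := normc_ge0 (1 - cdot (f z) (f a)).
  have N0' := normc_ge0 (1 - cdot z a).
  move: SP; rewrite aN !one_sub_nsq.
  have q1 := (enorm_lt1 z).1 z1; have q0 := enorm_ge0 z.
  have q1' := (enorm_lt1 _).1 fz1; have q0' := enorm_ge0 (f z).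
  have q1'' := (enorm_lt1 _).1 fa1; have q0'' := enorm_ge0 (f a).
  move: zK; rewrite ltr_pdivrMr ?subr_gt0//.
  move: za N0 N0' q1 q0 q1' q0' q1'' q0''.
  move: (normc _) (normc _) (enorm z) (enorm (f z)) (enorm (f a)).
  move=> F Z x y t Zs F0 Z0 x1 x0 y1 y0 t1 t0 yK H.
  have hZ : Z ^+ 2 <= (2 * s) ^+ 2 by rewrite lerXn2r// ?nnegrE; lra.
  have ht : 0 <= (1 - t) * (1 + t) <= 1 by nra.
  have hy : 0 <= (1 - y) * (1 + y) <= 2 * K * (1 - x) by nra.
  have hx : 1 - x <= (1 - x) * (1 + x) by nra.
  have hs : s <= 1 - (1 - s) ^+ 2 by nra.
  have xp : 0 < 1 - x by lra.
  have h1 : F ^+ 2 * (s * (1 - x)) <= F ^+ 2 * ((1 - (1 - s) ^+ 2) * ((1 - x) * (1 + x))).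
    by rewrite ler_wpM2l ?sqr_ge0// ler_pM// ltW.
  have h2 : Z ^+ 2 * ((1 - t) * (1 + t) * ((1 - y) * (1 + y))) <= (2 * s) ^+ 2 * (1 * (2 * K * (1 - x))).
    case/andP: ht => ht0 ht1; case/andP: hy => hy0 hy1.
    exact: (ler_pM (sqr_ge0 _) (mulr_ge0 ht0 hy0) hZ (ler_pM ht0 hy0 ht1 hy1)).
  have h3 := le_trans h1 (le_trans H h2).
  have : F ^+ 2 * (s * (1 - x)) <= (s * (8 * K)) * (s * (1 - x)).
    by apply: le_trans h3 _; rewrite le_eqVlt; apply/orP; left; apply/eqP; ring.
  rewrite ler_pM2r ?mulr_gt0// => h4.
  by rewrite -ler_sqr ?nnegrE ?(ltW m0)// (le_trans h4).
have fz0 : normc (1 - f z 0 0) < 2 * m.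
  have -> : 1 - f z 0 0 = (1 - cdot (f z) (f a)) + (cdot (f z) (f a) - f z 0 0) by ring.
  apply: le_lt_trans (le_normcD _ _) _.
  have := cdot_sub_e1_le (f a) (f z); have q1' := (enorm_lt1 _).1 fz1.
  have := enorm_ge0 (f z); have := enorm_ge0 (f a - e1); nra.
have := enorm_sub_e1_sq fz1.
rewrite -ltr_sqr ?nnegrE ?enorm_ge0 ?(ltW e0)//; lra.
Qed.

End Julia.

Section JuliaInequality.
Context {R : realType} {n : nat}.
Local Open Scope complex_scope.
Local Notation V := 'rV[R[i]]_n.+1.
Implicit Types (a b z : V) (f : V -> V).

Lemma le_of_small_errors (c C e0 : R) : 0 < e0 ->
  (forall e, 0 < e < e0 -> c <= e * C) -> c <= 0.
Proof.
move=> h0 H; rewrite leNgt; apply/negP => cp.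
have C0 : 0 < C.
  have e2 : 0 < e0 / 2 < e0 by lra.
  have := H _ e2; rewrite ltNge => le; apply/negP => C0.
  have : e0 / 2 * C <= 0 by rewrite mulr_ge0_le0// divr_ge0// ltW.
  lra.
pose e := Num.min (e0 / 2) (c / C / 2).
have ep : 0 < e by rewrite lt_min !divr_gt0.
have ee0 : e < e0 by rewrite gt_min; apply/orP; left; lra.
have eC : e * C <= c / 2.
  by rewrite -ler_pdivlMr// mulrAC ge_min lexx orbT.
have := H e; rewrite ep ee0 => /(_ isT); lra.
Qed.

(** Schwarz-Pick between z and a point w near e_1, with the factors depending on w
cancelled. Here r = |w|, t = |f(w)|, p = 1 - |z|^2, q = 1 - |f(z)|^2, and F, Z, y
are |1 - <f(z), f(w)>|, |1 - <z, w>| and |1 - z_1|. *)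
Lemma julia_arithmetic_quotients (al e y F Z p q r t : R) : 0 < e < 2^-1 ->
  Z <= y + e -> 1 - e <= r -> 0 <= y -> 0 <= Z -> 0 < p -> 0 < q ->
  0 <= t -> t < 1 -> r < 1 -> 1 - t < (al + e) * (1 - r) ->
  F ^+ 2 * ((1 - r) * (1 + r) * p) <= Z ^+ 2 * ((1 - t) * (1 + t) * q) ->
  F ^+ 2 * (2 - e) * p <= (y + e) ^+ 2 * (2 * (al + e)) * q.
Proof.
move=> e01 h2 h3 y0 Z0 p0 q0 t0 t1 r1 tr SP.
have e0 : 0 < e by lra.
have rp : 0 < 1 - r by lra.
have hZ : Z ^+ 2 <= (y + e) ^+ 2 by rewrite lerXn2r// ?nnegrE; lra.
rewrite -(ler_pM2r rp).
have h5 : F ^+ 2 * (2 - e) * p * (1 - r) <= F ^+ 2 * ((1 - r) * (1 + r) * p).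
  have -> : F ^+ 2 * (2 - e) * p * (1 - r) = F ^+ 2 * ((2 - e) * p * (1 - r)) by ring.
  rewrite ler_wpM2l ?sqr_ge0//.
  have : 0 <= (1 - r) * p * (r - (1 - e)) by rewrite !mulr_ge0 ?subr_ge0// ltW.
  lra.
have t2 : 0 <= (1 - t) * (1 + t) * q by rewrite !mulr_ge0//; lra.
have t3 : (1 - t) * (1 + t) * q <= 2 * (al + e) * (1 - r) * q.
  rewrite ler_pM2r//.
  have : 0 <= (1 - t) * (1 - t) by rewrite -expr2 sqr_ge0.
  lra.
apply: le_trans h5 (le_trans SP _).
have -> : (y + e) ^+ 2 * (2 * (al + e)) * q * (1 - r) =
          (y + e) ^+ 2 * (2 * (al + e) * (1 - r) * q) by ring.
exact: ler_pM (sqr_ge0 Z) t2 hZ t3.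
Qed.

(** Replaces |1 - <f(z), f(w)>| by x = |1 - f_1(z)| at the cost of an error linear
in e. *)
Lemma julia_arithmetic_errors (al e x y F p q : R) : 0 < al -> 0 < e < 2^-1 ->
  x <= F + e -> x <= 2 -> y <= 2 -> 0 <= x -> 0 <= y -> 0 <= F ->
  0 < p -> 0 < q -> p <= 1 -> q <= 1 ->
  F ^+ 2 * (2 - e) * p <= (y + e) ^+ 2 * (2 * (al + e)) * q ->
  x ^+ 2 * p - al * y ^+ 2 * q <= e * (8 + 4 + 5 * (al + 1)).
Proof.
move=> al0 e01 h1 x2 y2 x0 y0 F0 p0 q0 p1 q1 h4.
have e0 : 0 < e by lra.
have xe2 : 0 <= (2 - x) * e by rewrite mulr_ge0//; lra.
have h6 : x ^+ 2 - 4 * e <= F ^+ 2.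
  have [xe|ex] := leP x e.
    have := sqr_ge0 F; have : 0 <= x * (e - x) by rewrite mulr_ge0// subr_ge0.
    lra.
  have : (x - e) ^+ 2 <= F ^+ 2 by rewrite lerXn2r ?nnegrE; lra.
  have := sqr_ge0 e; lra.
have h7 : (x ^+ 2 - 4 * e) * (2 - e) * p <= F ^+ 2 * (2 - e) * p.
  by rewrite ler_pM2r// ler_pM2r//; lra.
have ee : 0 <= e * (1 - e) by rewrite mulr_ge0//; lra.
have sq4 (u : R) : 0 <= u -> u <= 2 -> u ^+ 2 <= 4.
  move=> u0 u2; have -> : 4 = 2 ^+ 2 :> R by ring.
  by rewrite lerXn2r// nnegrE.
have h8 : (y + e) ^+ 2 * (2 * (al + e)) * q <= (2 * al * y ^+ 2) * q + (8 + 10 * (al + 1)) * e.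
  have h10 : (y + e) ^+ 2 <= y ^+ 2 + 5 * e.
    have : 0 <= (2 - y) * e by rewrite mulr_ge0//; lra.
    lra.
  have h11 : (y + e) ^+ 2 * (2 * (al + e)) <= (y ^+ 2 + 5 * e) * (2 * (al + e)).
    by rewrite ler_wpM2r// mulr_ge0//; lra.
  have h12 : 0 <= e * (4 - y ^+ 2) by rewrite mulr_ge0 ?(ltW e0)// subr_ge0 sq4.
  have h13 : (y + e) ^+ 2 * (2 * (al + e)) <= 2 * al * y ^+ 2 + (8 + 10 * (al + 1)) * e by lra.
  apply: (@le_trans _ _ ((2 * al * y ^+ 2 + (8 + 10 * (al + 1)) * e) * q)).
    by rewrite ler_pM2r.
  rewrite mulrDl lerD2l ler_piMr// mulr_ge0//; lra.
have h9 : 2 * x ^+ 2 * p - 12 * e <= (x ^+ 2 - 4 * e) * (2 - e) * p.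
  have : 0 <= e * p * (4 - x ^+ 2) by rewrite !mulr_ge0// ?subr_ge0 ?sq4//; lra.
  have : 0 <= e * (1 - p) by rewrite mulr_ge0//; lra.
  have : 0 <= e * e * p by rewrite !mulr_ge0//; lra.
  lra.
lra.
Qed.

(** Let w tend to e_1 along points where the quotient tends to al in the
Schwarz-Pick inequality between z and w: then f(w) tends to e_1 as well. *)
Lemma julia_inequality f (al : R) : holomorphic_self_map f ->
  f (r%:C *: e1) @[r --> (1 : R)^'-] --> e1 -> 0 < al ->
  (forall e d : R, 0 < e -> 0 < d -> exists z : V, [/\ unit_ball z, enorm (z - e1) < d &
     (1 - enorm (f z)) / (1 - enorm z) < al + e]) ->
  forall z, unit_ball z ->
    normc (1 - f z 0 0) ^+ 2 * (1 - nsq z) <=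
    al * normc (1 - z 0 0) ^+ 2 * (1 - nsq (f z)).
Proof.
move=> hf rl al0 Hal z z1; have fz1 := hf.1 _ z1.
have al1 : 0 < al + 1 by lra.
rewrite -subr_le0; apply: (@le_of_small_errors _ (8 + 4 + 5 * (al + 1)) 2^-1); first by rewrite invr_gt0.
move=> e e01; have e0 : 0 < e by case/andP: e01.
have [d d0 Hd] := bounded_quotient_limit hf rl al1 e0.
have de0 : 0 < Num.min d e by rewrite lt_min d0.
have [w [w1 + wq]] := Hal e (Num.min d e) e0 de0; rewrite lt_min => /andP[wd we].
have fw1 := hf.1 _ w1.
have fwe : enorm (f w - e1) < e by apply: Hd => //; lra.
have SP := ball_schwarz_pick hf w1 z1.
have h1 : normc (1 - f z 0 0) <= normc (1 - cdot (f z) (f w)) + e.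
  have -> : 1 - f z 0 0 = (1 - cdot (f z) (f w)) + (cdot (f z) (f w) - f z 0 0) by ring.
  apply: le_trans (le_normcD _ _) _; rewrite lerD2l.
  have := cdot_sub_e1_le (f w) (f z); have := (enorm_lt1 _).1 fz1.
  have := enorm_ge0 (f z); have := enorm_ge0 (f w - e1); nra.
have h2 : normc (1 - cdot z w) <= normc (1 - z 0 0) + e.
  have -> : 1 - cdot z w = (1 - z 0 0) + - (cdot z w - z 0 0) by ring.
  apply: le_trans (le_normcD _ _) _; rewrite lerD2l normcN.
  have := cdot_sub_e1_le w z; have := (enorm_lt1 _).1 z1.
  have := enorm_ge0 z; have := enorm_ge0 (w - e1); nra.
have h3 : 1 - e <= enorm w.
  have := enormD w (e1 - w); rewrite (addrC w) subrK enorm_e1 -(enormN (e1 - w)) opprB; lra.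
have x2 : normc (1 - f z 0 0) <= 2.
  apply: le_trans (le_normcD _ _) _; rewrite normc1 normcN.
  by have := normc_coord_le (f z) 0; have := (enorm_lt1 _).1 fz1; lra.
have y2 : normc (1 - z 0 0) <= 2.
  apply: le_trans (le_normcD _ _) _; rewrite normc1 normcN.
  by have := normc_coord_le z 0; have := (enorm_lt1 _).1 z1; lra.
have x0 := normc_ge0 (1 - f z 0 0); have y0 := normc_ge0 (1 - z 0 0).
have F0 := normc_ge0 (1 - cdot (f z) (f w)); have Z0 := normc_ge0 (1 - cdot z w).
have p0 := unit_ball_gap z1; have q0 := unit_ball_gap fz1.
have p1 : 1 - nsq z <= 1 by have := nsq_ge0 z; lra.
have q1 : 1 - nsq (f z) <= 1 by have := nsq_ge0 (f z); lra.
rewrite one_sub_nsq (one_sub_nsq (f w)) in SP.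
have r1 := (enorm_lt1 w).1 w1; have t1 := (enorm_lt1 _).1 fw1.
rewrite ltr_pdivrMr ?subr_gt0// in wq.
apply: (julia_arithmetic_errors al0 e01 h1 x2 y2 x0 y0 F0 p0 q0 p1 q1).
exact: (julia_arithmetic_quotients e01 h2 h3 y0 Z0 p0 q0 (enorm_ge0 (f w)) t1 r1 wq SP).
Qed.

End JuliaInequality.

(** * The slice through e_1 *)

Section SliceDistances.
Context {R : realType} {n : nat}.
Local Open Scope complex_scope.
Local Notation V := 'rV[R[i]]_n.+1.
Implicit Types (a b z : V) (u v w x y : R[i]).

Lemma half_plane1 : half_plane (1 : R[i]).
Proof. by rewrite /half_plane /= ltr01. Qed.

Lemma nsq_slice x : nsq (x *: (e1 : V)) = normc x ^+ 2.
Proof. by rewrite nsqZ nsq_e1 mulr1. Qed.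

Lemma slice_ball x : unit_disc x -> unit_ball (x *: (e1 : V)).
Proof. by move=> x1; apply/enorm_lt1; rewrite enormZ enorm_e1 mulr1. Qed.

Lemma coord_disc b : unit_ball b -> unit_disc (b 0 0).
Proof. by move=> /enorm_lt1; apply: le_lt_trans; exact: normc_coord_le. Qed.

Lemma proj1_ball b : unit_ball b -> unit_ball (proj1 b).
Proof. by move=> /coord_disc; exact: slice_ball. Qed.

(** Equivalently, the square of the distance from b to its projection is
|b'|^2 / (1 - |b_1|^2), with b' the part of b orthogonal to e_1. *)
Lemma pdist_proj1 b : unit_ball b ->
  (1 - normc (b 0 0) ^+ 2) * (1 - pdist (proj1 b) b ^+ 2) = 1 - nsq b.
Proof.
move=> b1; have p1 := proj1_ball b1; have := pdist_gap p1 b1.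
have g := unit_disc_gap (coord_disc b1).
rewrite /proj1 nsq_slice cdotZr cdot_e1 one_sub_conjM normc_real gtr0_norm//.
by rewrite expr2 -mulrA => /(mulfI (lt0r_neq0 g)).
Qed.

(** On the slice, the pseudo-hyperbolic distance read in the half plane is
|v - u| / |v + u^*|, and |v + u^*| >= Re u. *)
Lemma pdist_slices u v : half_plane u -> half_plane v ->
  pdist (half_plane_to_disc 1 u *: (e1 : V)) (half_plane_to_disc 1 v *: e1) * Re u
    <= normc (v - u).
Proof.
move=> u0 v0; have h1 := half_plane1.
have x1 := half_plane_to_discP h1 u0; have y1 := half_plane_to_discP h1 v0.
have := pdist_gap (slice_ball x1) (slice_ball y1); rewrite !nsq_slice.
have gu := half_plane_to_disc_gap h1 u0; have gv := half_plane_to_disc_gap h1 v0.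
have guv := half_plane_to_disc_gap u0 v0.
have p0 : 0 <= pdist (half_plane_to_disc 1 u *: (e1 : V)) (half_plane_to_disc 1 v *: e1).
  exact: enorm_ge0.
move: p0; move: (pdist _ _) => p p0.
have du := half_plane_denom h1 u0; have dv := half_plane_denom h1 v0.
have duv := half_plane_denom u0 v0.
have E : (1 - cdot (half_plane_to_disc 1 v *: (e1 : V)) (half_plane_to_disc 1 u *: e1)) *
    ((v + 1^*%C) * (u + 1^*%C)^*%C) = 2 * (v + u^*%C).
  rewrite cdotZl cdotZr cdot_e1 [e1 0 0]mxE !eqxx mulr1.
  have uE : (half_plane_to_disc 1 u)^*%C = (u^*%C - 1) / (u^*%C + 1).
    rewrite /half_plane_to_disc conjc1 (rmorphM (@conjc R)) fmorphV.
    by rewrite (rmorphB (@conjc R)) (rmorphD (@conjc R)) rmorph1.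
  have uE' : (u + 1^*%C)^*%C = u^*%C + 1 by rewrite conjc1 (rmorphD (@conjc R)) rmorph1.
  have du' : u^*%C + 1 != 0 by rewrite -uE' conjc_eq0.
  rewrite uE uE' /half_plane_to_disc conjc1.
  move: dv; rewrite conjc1 => dv.
  by field; rewrite du'.
have {}E : normc (1 - cdot (half_plane_to_disc 1 v *: (e1 : V)) (half_plane_to_disc 1 u *: e1)) ^+ 2
   * (normc (v + 1^*%C) ^+ 2 * normc (u + 1^*%C) ^+ 2) = 4 * normc (v + u^*%C) ^+ 2.
  move/(congr1 (fun c : R[i] => normc c ^+ 2)): E; rewrite !normcM normc_conj !exprMn => ->.
  congr (_ * _); rewrite normc_sq /= ; ring.
have Ru : Re u <= normc (v + u^*%C).
  apply: le_trans (normr_Re_normc _); apply: le_trans (ler_norm _).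
  by move: u0 v0; rewrite /half_plane; case: (u) (v) => [a a'] [b b'] /= a0 b0; lra.
have Ru0 : 0 <= Re u by exact: ltW.
move: E; set D := normc (1 - _) ^+ 2 => E H.
have {}H : 4 * normc (v + u^*%C) ^+ 2 * (1 - p ^+ 2) =
    (4 * (Re (1 : R[i]) * Re u)) * (4 * (Re (1 : R[i]) * Re v)).
  rewrite -E -gu -gv mulrAC H; ring.
have {}H : normc (v + u^*%C) ^+ 2 * (1 - p ^+ 2) =
    normc (v + u^*%C) ^+ 2 * (1 - normc (half_plane_to_disc u v) ^+ 2).
  by rewrite guv; move: H; rewrite /=; lra.
have nz : normc (v + u^*%C) ^+ 2 != 0 by rewrite expf_neq0// gt_eqF// normc_gt0.
have {}H : p ^+ 2 = normc (half_plane_to_disc u v) ^+ 2.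
  by apply/oppr_inj/(addrI 1)/(mulfI nz).
have -> : p = normc (half_plane_to_disc u v).
  by apply/eqP; rewrite -(eqrXn2 (n:=2)) ?normc_ge0// H.
rewrite /half_plane_to_disc normcM normcV mulrAC ler_pdivrMr ?normc_gt0//.
by rewrite ler_wpM2l// normc_ge0.
Qed.

Lemma one_sub_half_plane_to_disc w : half_plane w ->
  normc (1 - half_plane_to_disc 1 w) * normc (w + 1) = 2.
Proof.
move=> /(half_plane_denom half_plane1); rewrite /half_plane_to_disc conjc1 => w1.
rewrite -normcM mulrBl mul1r divfK//.
have -> : w + 1 - (w - 1) = 2%:R%:C by rewrite rmorph_nat; ring.
by rewrite normc_real ger0_norm.
Qed.

Lemma Re_half_plane_to_disc w : half_plane w ->
  Re w * normc (1 - half_plane_to_disc 1 w) ^+ 2 = 1 - normc (half_plane_to_disc 1 w) ^+ 2.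
Proof.
move=> w0; have := Re_disc_to_half_plane 1 (half_plane_to_discP half_plane1 w0).
by rewrite half_plane_to_discK// ?mul1r//; exact: half_plane1.
Qed.

Lemma cone_sector (M : R) w : half_plane w -> cone M (half_plane_to_disc 1 w *: (e1 : V)) ->
  normc w <= 2 * M * Re w.
Proof.
move=> w0 [_]; have c1 := half_plane_to_discP half_plane1 w0.
have := Re_half_plane_to_disc w0; have := one_sub_half_plane_to_disc w0.
have -> : e1 - half_plane_to_disc 1 w *: (e1 : V) = (1 - half_plane_to_disc 1 w) *: e1.
  by rewrite scalerBl scale1r.
rewrite !enormZ enorm_e1 !mulr1.
have : normc w <= normc (w + 1).
  rewrite -ler_sqr ?nnegrE ?normc_ge0// !normc_sq.
  by move: w0; rewrite /half_plane; case: (w) => a b /= a0; lra.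
have d0 := normc_gt0 (disc_denom c1); have q0 := normc_ge0 (half_plane_to_disc 1 w).
rewrite /half_plane in w0; rewrite /unit_disc in c1.
move: (normc (1 - _)) (normc (half_plane_to_disc 1 w)) (normc (w + 1)) d0 q0 c1.
move=> d q N d0 q0 c1 wN dN E lt; apply: le_trans wN _.
rewrite -(ler_pM2l d0) dN.
have M0 : 0 < M.
  have : 0 < M * (1 - q) by exact: lt_trans lt.
  by rewrite pmulr_lgt0// subr_gt0.
have : d <= M * (Re w * d ^+ 2).
  rewrite E (le_trans (ltW lt))// ler_pM2l//.
  have : 0 <= q * (1 - q) by rewrite mulr_ge0// subr_ge0 ltW.
  lra.
have -> : M * (Re w * d ^+ 2) = d * (M * Re w * d) by ring.
by rewrite ler_pMr// => h; lra.
Qed.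

(** With zeta the point of the disc corresponding to w, |1 - zeta| = 2 / |w + 1| and
|1 - zeta| / (1 - |zeta|^2) = |w + 1| / (2 Re w), which is bounded in a
sector. *)
Lemma sector_Kregion (M t : R) w : half_plane w -> 0 < t -> normc w <= 2 * M * Re w ->
  2 / t + 2 <= normc w -> Kregion (4 * M + 1) t (half_plane_to_disc 1 w).
Proof.
move=> w0 t0 wM wt; have c1 := half_plane_to_discP half_plane1 w0.
have d0 := normc_gt0 (disc_denom c1).
have E := Re_half_plane_to_disc w0; have dN := one_sub_half_plane_to_disc w0.
have q0 := normc_ge0 (half_plane_to_disc 1 w).
have t20 : 0 < 2 / t by rewrite divr_gt0.
have N1 : normc (w + 1) <= normc w + 1 by rewrite (le_trans (le_normcD _ _))// normc1.
have N2 : normc w <= normc (w + 1) + 1.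
  by have := le_normcD (w + 1) (- 1); rewrite addrK normcN normc1.
rewrite /half_plane in w0; rewrite /unit_disc in c1.
rewrite /Kregion /=; move: d0 E dN N1 N2 q0 c1.
move: (normc (1 - _)) (normc (half_plane_to_disc 1 w)) (normc (w + 1)).
move=> d q N d0 E dN N1 N2 q0 c1.
split=> //; last first.
  have : 2 / t < N by lra.
  by rewrite ltr_pdivrMr// -dN mulrC ltr_pM2l//; lra.
have qp : 0 < 1 - q by rewrite subr_gt0.
rewrite ltr_pdivrMr// mulrDl mul1r.
suff : d <= 4 * M * (1 - q) by lra.
rewrite -(ler_pM2l w0).
have h1 : Re w * d ^+ 2 <= 2 * (1 - q).
  by rewrite E; have := sqr_ge0 (1 - q); lra.
have h2 : Re w * d <= (1 - q) * N.
  have -> : Re w * d = Re w * d ^+ 2 * N / 2.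
    have -> : Re w * d ^+ 2 * N / 2 = Re w * d * (d * N) / 2 by field.
    by rewrite dN mulfK.
  have : Re w * d ^+ 2 * N <= 2 * (1 - q) * N by rewrite ler_wpM2r//; lra.
  lra.
apply: le_trans h2 _.
have -> : Re w * (4 * M * (1 - q)) = (1 - q) * (4 * M * Re w) by ring.
by rewrite ler_pM2l//; lra.
Qed.

End SliceDistances.

(** * The angular derivative along the slice *)

Section JuliaWolffCaratheodory.
Context {R : realType}.
Local Open Scope complex_scope.
Implicit Types (G : R[i] -> R[i]) (u v w : R[i]).

(** Schwarz-Pick between w and a point a with Re (G a) <= e Re a reads, up to the
constant G(a), |G(w)|^2 <= 4 e |w|^2 |G(w)| / Re w. *)
Lemma sublinear_in_sectors G : (forall w, half_plane w -> differentiable G w) ->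
  (forall w, half_plane w -> half_plane (G w)) ->
  (forall e : R, 0 < e -> exists2 w, half_plane w & Re (G w) <= e * Re w) ->
  forall M eta : R, 0 < M -> 0 < eta -> exists K : R, forall w, half_plane w ->
    normc w <= M * Re w -> K <= normc w -> normc (G w) <= eta * Re w.
Proof.
move=> dG GH small M eta M0 eta0.
(* The inequality |G|^2 / 4 <= 4 e M |w| |G|, with |w| <= M Re w, gives
   |G| <= 16 e M^2 Re w. *)
have e0 : 0 < eta / (16 * M ^+ 2) by rewrite divr_gt0// mulr_gt0// exprn_gt0.
have [a a0 Ga] := small _ e0.
exists (Num.max (normc a) (2 * normc (G a) * M / eta)) => w w0 wM.
rewrite ge_max => /andP[wa]; rewrite ler_pdivrMr// => wG.
have [lt|ge] := leP (normc (G w)) (2 * normc (G a)).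
  rewrite (le_trans lt)// -(ler_pM2r M0) (le_trans wG)//.
  by rewrite mulrC -mulrA ler_pM2l// mulrC.
have SP := half_plane_schwarz_pick dG GH a0 w0.
have T1 : normc (w + a^*%C) <= 2 * normc w.
  by apply: le_trans (le_normcD _ _) _; rewrite normc_conj; lra.
have T2 : normc (G w) <= normc (G w + (G a)^*%C) + normc (G a).
  have := le_normcD (G w + (G a)^*%C) (- (G a)^*%C); rewrite addrK normcN normc_conj; exact.
have T3 : Re (G w) <= normc (G w).
  exact: le_trans (ler_norm _) (normr_Re_normc _).
have X0 := normc_ge0 (G a); have D0 := normc_ge0 (w + a^*%C).
have ga := GH _ a0; have gw := GH _ w0; have ny := normc_ge0 w.
rewrite /half_plane in a0 w0 ga gw.
move: (normc (G w + (G a)^*%C)) (normc (w + a^*%C)) T1 T2 D0 SP => A D T1 T2 D0 SP.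
have hA : normc (G w) / 2 <= A by lra.
have Xp : 0 < normc (G w) by lra.
have hA2 : normc (G w) ^+ 2 / 4 <= A ^+ 2.
  have -> : normc (G w) ^+ 2 / 4 = (normc (G w) / 2) ^+ 2 by rewrite exprMn; field.
  by rewrite lerXn2r// ?nnegrE; lra.
have hD2 : D ^+ 2 <= 4 * normc w * (M * Re w).
  apply: (@le_trans _ _ ((2 * normc w) ^+ 2)); first by rewrite lerXn2r// ?nnegrE ?mulr_ge0.
  have -> : (2 * normc w) ^+ 2 = 4 * normc w * normc w by ring.
  by rewrite ler_wpM2l// mulr_ge0.
have h1 : normc (G w) ^+ 2 / 4 * (Re a * Re w) <=
    4 * normc w * (M * Re w) * (eta / (16 * M ^+ 2) * Re a * normc (G w)).
  apply: le_trans (ler_wpM2r (mulr_ge0 (ltW a0) (ltW w0)) hA2) (le_trans SP _).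
  apply: ler_pM => //; first exact: sqr_ge0.
    by rewrite mulr_ge0// ltW.
  by apply: ler_pM => //; apply: ltW.
have h2 : normc (G w) ^+ 2 / 4 * (Re a * Re w) = normc (G w) / 4 * (normc (G w) * Re a * Re w) by field.
have h3 : 4 * normc w * (M * Re w) * (eta / (16 * M ^+ 2) * Re a * normc (G w)) =
   normc w * eta / (4 * M) * (normc (G w) * Re a * Re w) by field; rewrite gt_eqF.
move: h1; rewrite h2 h3 ler_pM2r ?mulr_gt0// => h1.
have h4 : normc w * eta / (4 * M) <= eta * Re w / 4.
  rewrite ler_pdivrMr ?mulr_gt0//.
  have -> : eta * Re w / 4 * (4 * M) = eta * (M * Re w) by field.
  by rewrite mulrC ler_pM2l.
have := le_trans h1 h4; lra.
Qed.

End JuliaWolffCaratheodory.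

Section Slice.
Context {R : realType} {n : nat}.
Local Open Scope complex_scope.
Local Notation V := 'rV[R[i]]_n.+1.
Variables (f : V -> V) (al : R).
Hypothesis hf : holomorphic_self_map f.
Hypothesis al0 : 0 < al.
Hypothesis julia : forall z, unit_ball z ->
  normc (1 - f z 0 0) ^+ 2 * (1 - nsq z) <=
  al * normc (1 - z 0 0) ^+ 2 * (1 - nsq (f z)).
Hypothesis dilation : forall e : R, 0 < e -> exists2 d : R, 0 < d & forall z : V, unit_ball z ->
  enorm (z - e1) < d -> al - e < (1 - enorm (f z)) / (1 - enorm z).

Definition slice_point (w : R[i]) : V := half_plane_to_disc 1 w *: e1.
Definition slice_map (w : R[i]) : R[i] := disc_to_half_plane 1 (f (slice_point w) 0 0).
(** The added constant 1 makes the real part positive, and not only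
nonnegative. *)
Definition slice_defect (w : R[i]) : R[i] := slice_map w - (al^-1)%:C * w + 1.

Lemma slice_point_ball w : half_plane w -> unit_ball (slice_point w).
Proof. by move=> w0; apply/slice_ball/half_plane_to_discP => //; exact: half_plane1. Qed.

Lemma slice_coord_disc w : half_plane w -> unit_disc (f (slice_point w) 0 0).
Proof. by move=> w0; apply/coord_disc/hf.1/slice_point_ball. Qed.

Lemma Re_slice_map w : half_plane w ->
  Re (slice_map w) * normc (1 - f (slice_point w) 0 0) ^+ 2 =
  1 - normc (f (slice_point w) 0 0) ^+ 2.
Proof. by move=> /slice_coord_disc; move/(Re_disc_to_half_plane 1) => ->; rewrite mul1r. Qed.

Lemma slice_map_half_plane w : half_plane w -> half_plane (slice_map w).
Proof. by move=> w0; apply: disc_to_half_planeP half_plane1 (slice_coord_disc w0). Qed.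

Lemma one_sub_slice_gt0 w : half_plane w -> 0 < normc (1 - f (slice_point w) 0 0) ^+ 2.
Proof. by move=> w0; rewrite exprn_gt0// normc_gt0// disc_denom// slice_coord_disc. Qed.

(** The Julia inequality on the slice: Re w is (1 - |zeta|^2) / |1 - zeta|^2. *)
Lemma slice_julia w : half_plane w ->
  Re w * normc (1 - f (slice_point w) 0 0) ^+ 2 <= al * (1 - nsq (f (slice_point w))).
Proof.
move=> w0; have h1 := @half_plane1 R.
have zD := half_plane_to_discP h1 w0.
have := julia (slice_point_ball w0); rewrite {2}/slice_point nsq_slice.
have E : slice_point w 0 0 = half_plane_to_disc 1 w by rewrite /slice_point !mxE !eqxx mulr1.
rewrite E; have := Re_disc_to_half_plane 1 zD; rewrite half_plane_to_discK// mul1r => <-.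
have d0 : 0 < normc (1 - half_plane_to_disc 1 w) ^+ 2.
  by rewrite exprn_gt0// normc_gt0// disc_denom.
by rewrite mulrA [X in _ <= X]mulrAC ler_pM2r// mulrC.
Qed.

Lemma slice_map_ge w : half_plane w -> al^-1 * Re w <= Re (slice_map w).
Proof.
move=> w0; have d0 := one_sub_slice_gt0 w0.
rewrite mulrC ler_pdivrMr// -(ler_pM2r d0) (le_trans (slice_julia w0))//.
rewrite mulrAC Re_slice_map// mulrC ler_pM2r// lerD2l lerN2.
rewrite /nsq (bigD1 0)//= lerDl; by apply: sumr_ge0 => j _; exact: sqr_ge0.
Qed.

Lemma Re_slice_defect w : Re (slice_defect w) = Re (slice_map w) - al^-1 * Re w + 1.
Proof. by rewrite /slice_defect; move: (slice_map w) => [a b]; case: w => c d /=; ring. Qed.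

Lemma slice_defect_half_plane w : half_plane w -> half_plane (slice_defect w).
Proof.
move=> w0; rewrite /half_plane Re_slice_defect; have := slice_map_ge w0; lra.
Qed.

Lemma slice_defect_differentiable w : half_plane w -> differentiable slice_defect w.
Proof.
move=> w0; have h1 := @half_plane1 R.
have ds : differentiable slice_point w.
  exact: differentiableZl (half_plane_to_disc_differentiable h1 w0).
have dfs := differentiable_comp ds (hf.2 _ (slice_point_ball w0)).
have dc : differentiable (fun w => f (slice_point w) 0 0) w.
  exact: (differentiable_comp dfs (@differentiable_coord _ _ _ _ 0 0)).
have dm : differentiable slice_map w.
  exact: (differentiable_comp dc (disc_to_half_plane_differentiable 1 (slice_coord_disc w0))).
have dl : differentiable (fun w : R[i] => (al^-1)%:C * w) w.
  rewrite (_ : (fun w => _) = fun w => 0 + (al^-1)%:C * w).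
    exact: cderiv_differentiable (cderiv_affine 0 (al^-1)%:C w).
  by apply/funext => v; rewrite add0r.
exact: (differentiableD (differentiableB dm dl) (differentiable_cst _ _)).
Qed.

(** On the radius, zeta = 1 - D, one has Re w = (2 - D) / D and
Re F(w) <= 2 / (1 - |phi|) <= 2 / (1 - |f(zeta e_1)|), which is at most
2 / ((al - e) D) near e_1 because al is the liminf: so
Re F(w) / Re w is asymptotically at most 1 / al. *)
Lemma slice_defect_small e : 0 < e ->
  exists2 w, half_plane w & Re (slice_defect w) <= e * Re w.
Proof.
move=> e0; pose b := al^-1; have b0 : 0 < b by rewrite invr_gt0.
have bal : b * al = 1 by rewrite mulVf// gt_eqF.
(* s (5 b + 1) bounds 2 b / (1 - s) - b (2 - s) + s. *)
have [s [s0 s2 se]] : exists s, [/\ 0 < s, s <= 2^-1 & s * (5 * b + 1) <= e].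
  have c0 : 0 < 5 * b + 1 by lra.
  exists (Num.min 2^-1 (e / (5 * b + 1))); split.
  - by rewrite lt_min invr_gt0 ltr0n divr_gt0.
  - by rewrite ge_min lexx.
  - by rewrite -ler_pdivlMr// ge_min lexx orbT.
have [d d0 Hd] := dilation (mulr_gt0 s0 al0).
pose D := Num.min (d / 2) s.
have Dp : 0 < D by rewrite lt_min s0 divr_gt0.
have Dd : D < d by rewrite gt_min; apply/orP; left; lra.
have Ds : D <= s by rewrite ge_min lexx orbT.
clearbody D.
have zD : unit_disc (1 - D)%:C.
  by rewrite /unit_disc normc_real ger0_norm; lra.
pose w := disc_to_half_plane 1 (1 - D)%:C.
have w0 : half_plane w by apply: disc_to_half_planeP => //; exact: half_plane1.
have pE : slice_point w = (1 - D)%:C *: e1.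
  by rewrite /slice_point disc_to_half_planeK//; exact: half_plane1.
exists w => //; rewrite Re_slice_defect -/b.
have n1 : normc (1 - (1 - D)%:C) = D.
  have -> : 1 - (1 - D)%:C = D%:C :> R[i] by rewrite rmorphB rmorph1; ring.
  by rewrite normc_real gtr0_norm.
have wD : Re w * D = 2 - D.
  have := Re_disc_to_half_plane 1 zD; rewrite n1 normc_real real_normK ?num_real// mul1r => H.
  apply: (mulIf (lt0r_neq0 Dp)); rewrite -mulrA -expr2 H; ring.
have pb := slice_point_ball w0.
have ez : enorm (slice_point w - e1) < d.
  rewrite pE (_ : _ - e1 = (- D%:C) *: e1); last first.
    by rewrite -[X in _ - X]scale1r -scalerBl rmorphB rmorph1; congr (_ *: _); ring.
  by rewrite enormZ enorm_e1 mulr1 normcN normc_real gtr0_norm.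
have en : 1 - enorm (slice_point w) = D.
  by rewrite pE enormZ enorm_e1 mulr1 normc_real ger0_norm; lra.
have := Hd _ pb ez; rewrite en ltr_pdivlMr// => Hfd.
have fx := normc_coord_le (f (slice_point w)) 0.
have x0 := normc_ge0 (f (slice_point w) 0 0).
have x1 : normc (f (slice_point w) 0 0) < 1 by exact: slice_coord_disc.
have tri : 1 - normc (f (slice_point w) 0 0) <= normc (1 - f (slice_point w) 0 0).
  have := le_normcD (1 - f (slice_point w) 0 0) (f (slice_point w) 0 0).
  by rewrite subrK normc1; lra.
have E := Re_slice_map w0; have F0 : 0 < Re (slice_map w) := slice_map_half_plane w0.
move: (Re (slice_map w)) (normc (f (slice_point w) 0 0)) (normc (1 - _)) (enorm (f _)) (Re w)
  wD Hfd fx x0 x1 tri E F0.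
clearbody b; clear -al0 e0 b0 bal s0 s2 se Dp Ds => F x Y y T wD Hfd fx x0 x1 tri E F0.
have Y2 : (1 - x) ^+ 2 <= Y ^+ 2 by rewrite lerXn2r ?nnegrE; lra.
have h1 : F * (1 - x) <= 1 + x.
  have x1' : 0 < 1 - x by lra.
  rewrite -(ler_pM2r x1').
  have : F * (1 - x) ^+ 2 <= F * Y ^+ 2 by rewrite ler_pM2l.
  rewrite E; lra.
have h2 : F * (al * (1 - s) * D) <= 2.
  have : F * (al * (1 - s) * D) <= F * (1 - x) by rewrite ler_pM2l//; lra.
  lra.
have h3 : F * D <= 2 * b * (1 + 2 * s).
  have s1 : 0 < 1 - s by lra.
  have h4 : F * D * (1 - s) <= 2 * b.
    have -> : F * D * (1 - s) = b * (F * (al * (1 - s) * D)).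
      by rewrite -[LHS]mul1r -bal; ring.
    by rewrite mulrC ler_pM2r.
  rewrite -(ler_pM2r s1) (le_trans h4)//.
  have s3 : 0 <= 1 - 2 * s by lra.
  have : 0 <= b * (s * (1 - 2 * s)) by rewrite (mulr_ge0 (ltW b0))// (mulr_ge0 (ltW s0)).
  lra.
rewrite -(ler_pM2r Dp) mulrDl mulrBl -!mulrA wD.
have bD : b * D <= b * s by rewrite ler_pM2l.
have eD : 0 <= e * (1 - D) by rewrite mulr_ge0//; lra.
lra.
Qed.

(** By [pdist_proj1], the Julia inequality divided by |1 - phi|^2 says that this
squared distance times Re F(w) is at most Re F(w) - Re w / al. *)
Lemma pdist_slice_proj1 w (rho : R) : half_plane w ->
  normc (slice_defect w) <= rho * Re w ->
  pdist (proj1 (f (slice_point w))) (f (slice_point w)) ^+ 2 <= al * rho.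
Proof.
move=> w0 Grho; have pb := slice_point_ball w0; have fb := hf.1 _ pb.
have J := slice_julia w0; have E := Re_slice_map w0; have D0 := one_sub_slice_gt0 w0.
have := pdist_proj1 fb; rewrite -E => P; rewrite -P in J.
have RG := le_trans (le_trans (ler_norm _) (normr_Re_normc (slice_defect w))) Grho.
rewrite Re_slice_defect in RG; have F0 := slice_map_ge w0.
rewrite /half_plane in w0; move: D0 J; set D := normc _ ^+ 2 => D0.
have p0 := sqr_ge0 (pdist (proj1 (f (slice_point w))) (f (slice_point w))).
move: (_ ^+ 2) p0 => p p0.
have -> : al * (Re (slice_map w) * D * (1 - p)) = al * Re (slice_map w) * (1 - p) * D by ring.
rewrite ler_pM2r// => J.
have aF : Re w <= al * Re (slice_map w) by move: F0; rewrite mulrC ler_pdivrMr// mulrC.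
have aG : al * Re (slice_map w) - Re w + al <= al * rho * Re w.
  have -> : al * Re (slice_map w) - Re w + al = al * (Re (slice_map w) - al^-1 * Re w + 1).
    by field; rewrite gt_eqF.
  by rewrite -mulrA ler_pM2l.
rewrite -(ler_pM2r w0).
have pF : p * Re w <= p * (al * Re (slice_map w)) by rewrite ler_wpM2l.
move: (Re (slice_map w)) (Re w) J aG pF => F W J aG pF.
have {}J : p * (al * F) <= al * F - W by lra.
by apply: le_trans pF (le_trans J _); have := al0; lra.
Qed.

(** F(w) - w / al is G(w) - 1. *)
Lemma pdist_slice_point w (rho : R) : half_plane w ->
  normc (slice_defect w) <= rho * Re w ->
  pdist (slice_point ((al^-1)%:C * w)) (proj1 (f (slice_point w))) * Re w <=
    al * (rho * Re w + 1).
Proof.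
move=> w0 Grho; have ai0 : 0 < al^-1 by rewrite invr_gt0.
have ReE : Re ((al^-1)%:C * w) = al^-1 * Re w by case: (w) => a b /=; ring.
have u0 : half_plane ((al^-1)%:C * w) by rewrite /half_plane ReE mulr_gt0.
have := pdist_slices (n := n) u0 (slice_map_half_plane w0).
rewrite disc_to_half_planeK//; [|exact: half_plane1|exact: slice_coord_disc].
rewrite ReE -/(slice_point _) -/(proj1 (f (slice_point w))) mulrCA mulrC ler_pdivrMr//.
move=> /le_trans; apply; rewrite mulrC ler_pM2l//.
have -> : slice_map w - (al^-1)%:C * w = slice_defect w + - 1 by rewrite /slice_defect; ring.
by apply: le_trans (le_normcD _ _) _; rewrite normcN normc1 lerD2r.
Qed.

End Slice.

(** * Approximation of an admissible set by the image of a Stolz region *)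

Theorem corollary2p6 (R : realType) (n : nat)
    (f : 'rV[R[i]]_n.+1 -> 'rV[R[i]]_n.+1)
    (hf : holomorphic_self_map f)
    (hfix : boundary_regular_fixed_point f) :
  forall (eps : R) (t : R) (A : set 'rV[R[i]]_n.+1),
    0 < eps -> 0 < t < 1 -> admissible A ->
    exists M delta : R,
      [/\ 1 < M, 0 < delta
        & forall z, (A `&` eball e1 delta) z ->
            (kobayashi_set z (f @` Kregion_e1 M t) < eps%:E)%E].
Proof.
move: hfix => [hlim hrad] eps t A eps0 /andP[t0 t1] [Aball _ Aadm].
have o1 := @unit_ball0 R n.
have c0 : 0 < (1 - enorm (f 0)) / 2.
  by rewrite divr_gt0// subr_gt0; apply/enorm_lt1; exact: hf.1.
have [al [cal Hinf Hsup]] := liminf_real (fun z => dilation_quotient_ge hf) hlim.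
have al0 : 0 < al by exact: lt_le_trans c0 cal.
have julia := julia_inequality hf hrad al0 Hinf.
have eps3 : 0 < eps / 3 by rewrite divr_gt0.
have [d0 [M0 [d00 M01 Acone Akob]]] := Aadm _ eps3.
have [eta eta0 small] := @kobayashi_small R n _ eps3.
have h1 := @half_plane1 R.
(* The tolerance for the defect: the two distances in the image will be at most
   2 al rho and the square root of al rho, both less than eta. *)
pose rho := Num.min (eta / 4) (eta ^+ 2 / 4) / al.
have rho0 : 0 < rho by rewrite divr_gt0// lt_min !divr_gt0// exprn_gt0.
have rho1 : al * rho <= eta / 4 by rewrite mulrC divfK ?gt_eqF// ge_min lexx.
have rho2 : al * rho <= eta ^+ 2 / 4 by rewrite mulrC divfK ?gt_eqF// ge_min lexx orbT.
clearbody rho.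
have M00 : 0 < 2 * M0 by lra.
have [K HK] := sublinear_in_sectors (slice_defect_differentiable al hf)
  (slice_defect_half_plane hf al0 julia) (slice_defect_small hf al0 Hsup) M00 rho0.
(* K for the sector estimate, 2 M0 / rho for 1 <= rho Re w, and 2 / t + 2 for
   the condition |1 - zeta| < t. *)
pose K1 := Num.max (Num.max K (2 * M0 / rho)) (2 / t + 2).
have K1K : K <= K1 by rewrite !le_max lexx.
have K1r : 2 * M0 / rho <= K1 by rewrite !le_max lexx orbT.
have K1t : 2 / t + 2 <= K1 by rewrite !le_max lexx !orbT.
clearbody K1.
have t20 : 0 < 2 / t by rewrite divr_gt0.
have K10 : 0 < K1 by lra.
exists (4 * M0 + 1), (Num.min d0 (2 / (K1 / al + 1))).
have KD0 : 0 < K1 / al + 1 by rewrite addr_gt0// divr_gt0.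
split; [lra|by rewrite lt_min d00 divr_gt0|].
move=> z [zA]; rewrite /eball /= lt_min => /andP[zd0 zd].
have z1 := Aball z zA.
have zAd : (A `&` eball e1 d0) z by [].
have kz := Akob z zAd.
have pz1 := proj1_ball z1.
have pzcone : cone M0 (proj1 z) by apply: Acone; exists z.
have zD := coord_disc z1.
pose u := disc_to_half_plane 1 (z 0 0).
have u0 : half_plane u by exact: disc_to_half_planeP.
have pzE : slice_point u = proj1 z by rewrite /slice_point disc_to_half_planeK.
have uM : normc u <= 2 * M0 * Re u by apply: (@cone_sector R n M0 u u0); rewrite -/(slice_point u) pzE.
pose w := al%:C%C * u.
have ReE : Re w = al * Re u by rewrite /w; case: (u) => a b /=; ring.
have w0 : half_plane w by rewrite /half_plane ReE mulr_gt0.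
have nE : normc w = al * normc u by rewrite normcM normc_real gtr0_norm.
have wM : normc w <= 2 * M0 * Re w by rewrite nE ReE mulrCA ler_pM2l.
have wK : K1 <= normc w.
  have nu := one_sub_half_plane_to_disc u0.
  rewrite disc_to_half_planeK// in nu.
  have d1 : normc (1 - z 0 0) < 2 / (K1 / al + 1).
    exact: le_lt_trans (one_sub_coord_le z) zd.
  rewrite ltr_pdivlMr// -nu ltr_pM2l ?normc_gt0 ?disc_denom// in d1.
  have := le_normcD u 1; rewrite normc1 nE => h.
  have : K1 / al <= normc u by clear -d1 h; lra.
  by rewrite ler_pdivrMr// mulrC.
have Gw : normc (slice_defect f al w) <= rho * Re w.
  by apply: HK => //; exact: le_trans wK.
have rw1 : 1 <= rho * Re w.
  have : 2 * M0 / rho <= 2 * M0 * Re w by apply: le_trans wM; exact: le_trans wK.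
  by rewrite ler_pdivrMr// mulrAC -mulrA ler_pMr// mulrC.
have uE : (al^-1)%:C%C * w = u.
  by rewrite /w mulrA -rmorphM mulVf ?gt_eqF// rmorph1 mul1r.
have b1 := hf.1 _ (slice_point_ball w0).
have pb1 := proj1_ball b1.
have k2 : kobayashi (proj1 z) (proj1 (f (slice_point w))) < eps / 3.
  apply: small => //; have := pdist_slice_point hf al0 w0 Gw.
  rewrite uE pzE => H.
  apply: (@le_lt_trans _ _ (2 * (al * rho))); last by clear -rho1 eta0; lra.
  rewrite -(ler_pM2r w0) (le_trans H)//.
  have -> : 2 * (al * rho) * Re w = al * (2 * (rho * Re w)) by ring.
  by rewrite ler_pM2l//; clear -rw1; lra.
have k3 : kobayashi (proj1 (f (slice_point w))) (f (slice_point w)) < eps / 3.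
  apply: small => //; have := pdist_slice_proj1 hf al0 julia w0 Gw => H.
  rewrite -(@ltr_pXn2r _ 2) ?nnegrE ?enorm_ge0 ?(ltW eta0)//.
  have := exprn_gt0 2 eta0; clear -H rho2; lra.
apply: (@le_lt_trans _ _ (kobayashi z (f (slice_point w)))%:E).
  apply: ereal_inf_lbound; exists (f (slice_point w)) => //.
  exists (slice_point w) => //; exists (half_plane_to_disc 1 w) => //.
  by apply: sector_Kregion => //; exact: le_trans wK.
rewrite lte_fin.
apply: le_lt_trans (kobayashi_triangle z1 b1 pz1) _.
have -> : eps = eps / 3 + (eps / 3 + eps / 3) by clear; field.
apply: (ltrD kz); apply: le_lt_trans (kobayashi_triangle pz1 b1 pb1) _.
exact: (ltrD k2 k3).
Qed.
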